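(* For every forest $T$, there exists $d\ge 2$ such that every non-complete $T$-free graph $G$ contains an anticomplete pair $(A,B)$ with $\rho(A),\rho(B)\ge\omega(G)^{-d}\rho(G)$.
   Context: All graphs are finite, simple. $G$ is $T$-free if it has no induced subgraph isomorphic to $T$; $|G|$ is the number of vertices, $\alpha(G)$ the stability number, $\omega(G)$ the clique number. $\psi(G)=|G|/\alpha(G)$ if $|G|\ge1$ and $0$ otherwise; the Hall ratio $\rho(G)$ is the maximum of $\psi(F)$ over induced subgraphs $F$ of $G$; $\rho(S):=\rho(G[S])$ for $S\subseteq V(G)$. An anticomplete pair is a pair $(A,B)$ of disjoint vertex subsets with no edges between $A$ and $B$. *)

(* Defs.v *)
From mathcomp Require Import all_boot all_order all_algebra.

Set Implicit Arguments.
Unset Strict Implicit.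
Unset Printing Implicit Defensive.

Import Order.TTheory GRing.Theory Num.Theory.
Local Open Scope ring_scope.

Record sgraph := SGraph {
  vertex :> finType;
  adj : rel vertex;
  adj_sym : symmetric adj;
  adj_irr : irreflexive adj
}.

Section Induced.
Variables (G : sgraph) (S : {set G}).

Definition induced_adj : rel {x : G | x \in S} :=
  fun x y => adj (val x) (val y).

Lemma induced_adj_sym : symmetric induced_adj.
Proof. by move=> x y; exact: adj_sym. Qed.

Lemma induced_adj_irr : irreflexive induced_adj.
Proof. by move=> x; exact: adj_irr. Qed.

Definition induced : sgraph := SGraph induced_adj_sym induced_adj_irr.

End Induced.

Definition isomorphic (G H : sgraph) : Prop :=
  exists2 f : G -> H, bijective f & forall x y, adj (f x) (f y) = adj x y.

Definition free_of (T G : sgraph) : Prop :=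
  forall S : {set G}, ~ isomorphic (induced S) T.

(* For a symmetric relation, every edge xy makes [:: x; y] a [cycle] in the
   sense of path.v; graph cycles are those with at least 3 vertices. *)
Definition forest (G : sgraph) : Prop :=
  ~ exists s : seq G, [/\ (3 <= size s)%N, uniq s & cycle (@adj G) s].

Definition complete (G : sgraph) : Prop :=
  forall x y : G, x != y -> adj x y.

Definition stable (G : sgraph) (S : {set G}) : bool :=
  [forall x in S, forall y in S, ~~ adj x y].

Definition clique (G : sgraph) (S : {set G}) : bool :=
  [forall x in S, forall y in S, (x != y) ==> adj x y].

Definition alpha (G : sgraph) : nat := \max_(S : {set G} | stable S) #|S|.

Definition omega (G : sgraph) : nat := \max_(S : {set G} | clique S) #|S|.

Definition psi (G : sgraph) : rat :=
  if (1 <= #|G|)%N then #|G|%:R / (alpha G)%:R else 0.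

(* The default value 0 is itself attained, at the null subgraph, so this is
   the maximum of psi over all induced subgraphs. *)
Definition rho (G : sgraph) : rat :=
  \big[Num.max/0]_(S : {set G}) psi (induced S).

Definition rho_set (G : sgraph) (S : {set G}) : rat := rho (induced S).

Definition anticomplete (G : sgraph) (A B : {set G}) : Prop :=
  [disjoint A & B] /\ forall a b, a \in A -> b \in B -> ~~ adj a b.

(* Main.v *)
Require Import Defs.
From mathcomp Require Import all_boot all_order all_algebra.
From mathcomp Require Import zify lra.
From mathcomp Require Import boolp.
From mathcomp Require filter.

Set Implicit Arguments.
Unset Strict Implicit.
Unset Printing Implicit Defensive.

Import Order.TTheory GRing.Theory Num.Theory.

(** Suppose the theorem fails for T. Take a counterexample for every exponent d, restrict it to
    an induced subgraph attaining the Hall ratio, and argue along a nonprincipal ultrafilter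
    on d: there, a set is "big" if it contains a fraction at least omega^-q of the vertices for
    a fixed q, and no two disjoint big sets are anticomplete. T is an induced subgraph of some
    rooted tree, given by a parent function par with par v < v.

    First, counting copies of the initial segments of that tree shows that every big set
    contains two disjoint big sets, sparse to each other; iterating, we get arbitrarily long
    blockades of big, pairwise sparse blocks. All further work takes place in blockades whose
    blocks may be shrunk; Ramsey's theorem makes the behaviour of subblockades uniform.
    If in some long blockade every block could be used to cover (after shrinking) any chosen later
    block while missing the others, the tree could be embedded greedily. Hence such covers can be
    excluded, from the left and from the right.

    Now we grow trees of full branching whose root lies in a block before (or after) the blocks
    of all other vertices. In a blockade L ++ X ++ R, small trees living in X meet few vertices of
    L and R. Comparing the degrees of the vertices of X into a pool of vertices of L and R, either
    the root of some tree has far larger degree than its other vertices, or the degrees in many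
    blocks are comparable, which produces an excluded cover. So the first outcome always
    holds, and removing from the pool the neighbourhoods of such trees one after the other we find
    a big subset of some block of L or R, every vertex of which is attached to a
    tree precisely at its root. Repeating this with the same hub block, a vertex gets many such
    trees attached, and this is either a larger tree rooted at the hub or a new branch at the root
    of the last tree. Eventually the tree contains T. *)

(** * Ramsey's theorem for subsequences *)

(** Induction on [r], then on the sum of the targets [mf k]. The first entry x colours the shorter
    subsequences y of the rest by [col (x :: y)]; inside a part where this colour is constantly i,
    the inner induction is used with the target for i lowered by one, and x makes up the
    difference. *)
Lemma ramsey_offdiag r c (mf : nat -> nat) : exists K, forall (s : seq nat) (col : seq nat -> nat),
  K <= size s -> (forall x, col x < c) ->
  exists h k, [/\ k < c, subseq h s, size h = mf k
     & forall x, subseq x h -> size x = r -> col x = k].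
Proof.
elim: r mf => [|r IHr] mf.
  exists (\sum_(k < c) mf k) => s col hs hc.
  exists (take (mf (col [::])) s), (col [::]); split=> //.
  - exact: take_subseq.
  - rewrite size_take; case: ltnP => // hle.
    have : mf (col [::]) <= \sum_(k < c) mf k.
      by rewrite (bigD1 (Ordinal (hc [::]))) //= leq_addr.
    by move=> h2; apply/eqP; rewrite eqn_leq hle (leq_trans h2 hs).
  - by move=> x _ /size0nil ->.
have [N] := ubnP (\sum_(k < c) mf k); elim: N mf => // N IHN mf hN.
have [[k kc mk0]|mpos] := pselect (exists2 k, k < c & mf k = 0).
  exists 0 => s col _ _; exists [::], k; split=> //; first exact: sub0seq.
  by move=> x; rewrite subseq0 => /eqP->.
pose mfi i k := if k == i then (mf k).-1 else mf k.
have sub_lt i : i < c -> \sum_(k < c) mfi i k < N.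
  move=> ic; have mi : 0 < mf i.
    by rewrite lt0n; apply/eqP => h; apply: mpos; exists i.
  suff : \sum_(k < c) mfi i k < \sum_(k < c) mf k by lia.
  rewrite (bigD1 (Ordinal ic)) //= [X in _ < X](bigD1 (Ordinal ic)) //=.
  rewrite {1}/mfi eqxx; under eq_bigr => k hk.
    have -> : mfi i k = mf k by rewrite /mfi ifN //.
    over.
  by lia.
have /choice [KK hKK] : forall i, exists K, i < c -> forall (s : seq nat) (col : seq nat -> nat),
  K <= size s -> (forall x, col x < c) ->
  exists h k, [/\ k < c, subseq h s, size h = mfi i k
     & forall x, subseq x h -> size x = r.+1 -> col x = k].
  move=> i; have [ic|ic] := boolP (i < c); last by exists 0.
  by have [K hK] := IHN (mfi i) (sub_lt i ic); exists K.
have [K hK] := IHr KK.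
exists K.+1 => -[//|x s] col /= hs hc.
have [h' [i [ic hsub hsz hcol]]] := hK s (fun y => col (x :: y)) hs (fun y => hc _).
have [h [k [kc hs2 hsz2 hcol2]]] := hKK i ic h' col (eq_leq (esym hsz)) hc.
have [ki|ki] := eqVneq k i; last first.
  exists h, k; split=> //; last by rewrite hsz2 /mfi (negbTE ki).
  exact: subseq_trans hs2 (subseq_trans hsub (subseq_cons _ _)).
exists (x :: h), k; split=> //.
- by rewrite /= eqxx; exact: subseq_trans hs2 hsub.
- rewrite /= hsz2 /mfi ki eqxx prednK // lt0n; apply/eqP => h0.
  by apply: mpos; exists i.
- case=> [//|y0 y] /=; case: eqP => [->|_] hy [hsy]; last by apply: hcol2 => //=; rewrite hsy.
  by rewrite ki; apply: hcol => //; exact: subseq_trans hy hs2.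
Qed.

Lemma ramsey r c m : exists K, forall (s : seq nat) (col : seq nat -> nat),
  K <= size s -> (forall x, col x < c) ->
  exists h k, [/\ k < c, subseq h s, size h = m
     & forall x, subseq x h -> size x = r -> col x = k].
Proof. exact: (ramsey_offdiag r c (fun=> m)). Qed.

(** * Neighbourhood counts and greedy covers *)

Section FiniteGraph.
Variables (V : finType) (e : rel V).
Hypothesis e_sym : symmetric e.

Definition nb (v : V) (X : {set V}) := [set x in X | e v x].
Definition touched (A X : {set V}) := [set x in X | [exists a in A, e a x]].
Definition acomp (A X : {set V}) := forall a x, a \in A -> x \in X -> ~~ e a x.

Lemma nbS v (X Y : {set V}) : X \subset Y -> nb v X \subset nb v Y.
Proof. by move=> /subsetP h; apply/subsetP => x; rewrite !inE => /andP[/h -> ->]. Qed.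

Lemma double_count (H X : {set V}) : \sum_(h in H) #|nb h X| = \sum_(x in X) #|nb x H|.
Proof.
under eq_bigr => h _ do rewrite -sum1dep_card big_mkcondr /=.
rewrite exchange_big /=; apply: eq_bigr => x xX.
by rewrite -sum1dep_card big_mkcondr /=; apply: eq_bigr => h _; rewrite e_sym.
Qed.

Lemma touchedU1 h R X : touched (h |: R) X = touched R X :|: nb h (X :\: touched R X).
Proof.
apply/setP => x; rewrite !inE; case xX: (x \in X) => //=.
apply/existsP/orP => [[a /andP[]]|[/existsP[a /andP[aR eax]]|/andP[_ hx]]].
- rewrite !inE => /orP[/eqP-> eh|aR eax]; last by left; apply/existsP; exists a; rewrite aR.
  by case: existsP => ?; [left|right]; rewrite ?andbT.
- by exists a; rewrite !inE aR orbT.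
- by exists h; rewrite !inE eqxx.
Qed.

Lemma card_touchedU1 h R X :
  #|touched (h |: R) X| = #|touched R X| + #|nb h (X :\: touched R X)|.
Proof.
rewrite touchedU1 cardsU (_ : _ :&: _ = set0) ?cards0 ?subn0 //.
by apply/setP => x; rewrite !inE; case: (x \in X); case: existsP => //; rewrite ?andbF.
Qed.

Lemma touched_sub A X : touched A X \subset X.
Proof. by apply/subsetP => x; rewrite inE => /andP[]. Qed.

Lemma touched0 X : touched set0 X = set0.
Proof. by apply/setP => x; rewrite !inE; apply/negbTE/negP => /andP[_ /existsP[a]]; rewrite inE. Qed.

Local Open Scope ring_scope.

(* Vertices of H are added one at a time, each time one that touches much more
   of the rest of [Ls] than of the sets [J j] in relative terms. *)
Lemma greedy_touch k (H Ls : {set V}) (J : 'I_k -> {set V}) (Q Lam : nat) :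
  (0 < Q)%N -> (0 < Lam)%N -> (0 < #|Ls|)%N ->
  (forall x, x \in Ls -> (Q <= 2 * #|nb x H|)%N) ->
  (forall j x, x \in J j -> (#|nb x H| <= Lam * Q)%N) ->
  (forall h, h \in H -> (32 * (k.+1 * Lam) * #|nb h Ls| <= #|Ls|)%N) ->
  exists R : {set V}, [/\ R \subset H, (#|Ls| <= 32 * (k.+1 * Lam) * #|touched R Ls|)%N
    & forall j, (2 * #|touched R (J j)| <= #|J j|)%N].
Proof.
move=> Q0 L0 Ls0 hQ hJ hsmall.
set c := (k.+1 * Lam)%N; have c0 : (0 < c)%N by rewrite muln_gt0.
pose fr (X Y : {set V}) : rat := #|X|%:R / #|Y|%:R.
have fr0 X Y : 0 <= fr X Y by rewrite divr_ge0.
have Lsp : 0 < #|Ls|%:R :> rat by rewrite ltr0n.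
(* The cap on [touched R Ls] bounds the right side of the middle clause by 1/2, so each [J j] stays
   at least half untouched. R is then chosen to touch as much of [Ls] as possible. *)
pose inv (R : {set V}) := [&& R \subset H,
  \sum_j fr (touched R (J j)) (J j) <= (8 * c)%:R * fr (touched R Ls) Ls
  & (32 * c * #|touched R Ls| <= 2 * #|Ls|)%N].
have inv0 : inv set0.
  apply/and3P; split; rewrite ?sub0set ?touched0 ?cards0 ?muln0 //.
  rewrite big1 => [|j _]; last by rewrite /fr touched0 cards0 mul0r.
  by apply: mulr_ge0; [exact: ler0n | exact: fr0].
case: (arg_maxnP (fun R : {set V} => #|touched R Ls|) inv0) => R /and3P[RH Rs Rle] Rmax.
exists R; split=> //; last first.
  move=> j; have [J0|Jj0] := posnP #|J j|; last first.
    have Jp : 0 < #|J j|%:R :> rat by rewrite ltr0n.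
    have h1 : fr (touched R (J j)) (J j) <= (8 * c)%:R * fr (touched R Ls) Ls.
      by apply: le_trans Rs; rewrite (bigD1 j) //= lerDl sumr_ge0.
    have h2 : (8 * c)%:R * fr (touched R Ls) Ls <= 1 / 2%:R.
      have : (32 * c * #|touched R Ls|)%:R <= (2 * #|Ls|)%:R :> rat by rewrite ler_nat.
      rewrite /fr mulrA ler_pdivrMr //.
      rewrite !natrM; lra.
    have : fr (touched R (J j)) (J j) <= 1 / 2%:R by apply: le_trans h2.
    rewrite /fr ler_pdivrMr // => h3.
    rewrite -(ler_nat rat) natrM; lra.
  by have /subset_leq_card := touched_sub R (J j); rewrite J0; case: #|_|.
rewrite leqNgt; apply/negP => hlt.
set U := Ls :\: touched R Ls.
(* Otherwise summing over H and counting edges from the other end is contradictory: the vertices of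
   U, at least half of [Ls], have at least Q/2 neighbours in H each, those of the [J j] at most
   [Lam * Q]. *)
have [h hH hgt] : exists2 h, h \in H &
   \sum_j fr (nb h (J j :\: touched R (J j))) (J j) < (8 * c)%:R * fr (nb h U) Ls.
  apply: contrapT => hno.
  have hle h : h \in H -> (8 * c)%:R * fr (nb h U) Ls <=
     \sum_j fr (nb h (J j :\: touched R (J j))) (J j).
    by move=> hH; rewrite leNgt; apply/negP => hh; apply: hno; exists h.
  have : \sum_(h in H) (8 * c)%:R * fr (nb h U) Ls <=
     \sum_(h in H) \sum_j fr (nb h (J j :\: touched R (J j))) (J j) by exact: ler_sum.
  rewrite -mulr_sumr /fr -mulr_suml -natr_sum double_count exchange_big /=.
  have hU : (#|Ls| <= 2 * #|U|)%N.
    have := cardsID (touched R Ls) Ls.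
    rewrite (setIidPr (touched_sub R Ls)) -/U.
    by move: hlt c0; rewrite -/c; nia.
  have hs1 : ((Q * #|U|)%N <= 2 * \sum_(x in U) #|nb x H|)%N.
    rewrite mulnC -sum_nat_const big_distrr /=; apply: leq_sum => x.
    by rewrite inE => /andP[_ /hQ].
  have hs2 : \sum_j (\sum_(h in H) #|nb h (J j :\: touched R (J j))|%:R / #|J j|%:R : rat)
      <= (k * (Lam * Q))%:R.
    apply: (@le_trans _ _ (\sum_(j < k) (Lam * Q)%:R)); last first.
      by rewrite sumr_const card_ord [leRHS]natrM mulr_natl.
    apply: ler_sum => j _; rewrite -mulr_suml -natr_sum double_count.
    have [J0|Jp] := posnP #|J j|; first by rewrite J0 invr0 mulr0.
    rewrite ler_pdivrMr ?ltr0n // -natrM ler_nat.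
    apply: (@leq_trans (\sum_(x in J j :\: touched R (J j)) Lam * Q)%N).
      by apply: leq_sum => x; rewrite inE => /andP[_ /hJ].
    by rewrite sum_nat_const mulnC leq_mul2l subset_leq_card ?subsetDl ?orbT.
  move=> hh; have {hh}hh := le_trans hh hs2.
  have h4 : (Q%:R : rat) / 4%:R <= (\sum_(x in U) #|nb x H|)%:R / #|Ls|%:R.
    rewrite ler_pdivlMr // mulrAC ler_pdivrMr ?ltr0n //.
    rewrite -!natrM ler_nat; nia.
  have : (8 * c)%:R * (Q%:R / 4%:R) <= (k * (Lam * Q))%:R :> rat.
    by apply: le_trans hh; apply: ler_wpM2l.
  rewrite mulrA ler_pdivrMr ?ltr0n // -!natrM ler_nat /c.
  have : (0 < Lam * Q)%N by rewrite muln_gt0 L0.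
  by nia.
have hpos : (0 < #|nb h U|)%N.
  rewrite lt0n; apply/eqP => h0; move: hgt; rewrite /fr h0 mul0r mulr0 ltNge.
  by rewrite sumr_ge0 // => j _; rewrite divr_ge0.
have : inv (h |: R).
  apply/and3P; split.
  - by rewrite subUset sub1set hH.
  - rewrite /fr; under eq_bigr => j _ do rewrite card_touchedU1 natrD mulrDl.
    rewrite big_split /= card_touchedU1 natrD mulrDl mulrDr.
    by apply: lerD => //; apply: ltW.
  - rewrite card_touchedU1 mulnDr.
    have := hsmall h hH; rewrite -/c.
    have : (#|nb h U| <= #|nb h Ls|)%N by apply: subset_leq_card; apply: nbS; apply: subsetDl.
    by rewrite -/U; nia.
move=> /Rmax; rewrite card_touchedU1 -/U; lia.
Qed.

End FiniteGraph.

(** * Collecting vertices attached to trees at their roots *)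

Section Attachment.
Variables (V : finType) (e : rel V).
Hypothesis e_sym : symmetric e.
Local Notation touched := (touched e).
Local Notation acomp := (acomp e).

(** lo is the least value with a quarter of B at or below it, hi the greatest with a quarter at or
    above it. By extremality at most a quarter of B lies strictly below lo, and at most a quarter
    strictly above hi. *)
Lemma quantiles (B : {set V}) (f : V -> nat) : exists lo hi,
  [/\ #|B| <= 4 * #|[set x in B | f x <= lo]|,
      #|B| <= 4 * #|[set x in B | hi <= f x]|
    & #|B| <= 2 * #|[set x in B | lo <= f x <= hi]|].
Proof.
have [B0|Bpos] := posnP #|B|; first by exists 0, 0; rewrite B0.
pose mx := \max_(x in B) f x.
have fmx x : x \in B -> f x <= mx by move=> xB; apply: leq_bigmax_cond.
have exlo : exists l, #|B| <= 4 * #|[set x in B | f x <= l]|.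
  exists mx; rewrite (_ : [set x in B | _] = B) ?leq_pmull //.
  by apply/setP => x; rewrite inE; case xB: (x \in B) => //=; rewrite fmx.
have exhi : exists l, #|B| <= 4 * #|[set x in B | l <= f x]|.
  exists 0; rewrite (_ : [set x in B | _] = B) ?leq_pmull //.
  by apply/setP => x; rewrite inE andbT.
have ubhi l : #|B| <= 4 * #|[set x in B | l <= f x]| -> l <= mx.
  move=> hl; rewrite leqNgt; apply/negP => lmx; move: hl.
  rewrite (_ : [set x in B | _] = set0) ?cards0; first by rewrite muln0 leqNgt Bpos.
  apply/setP => x; rewrite !inE; apply/negbTE/negP => /andP[/fmx h1 h2]; lia.
case: (ex_minnP exlo) => lo hlo minlo.
case: (ex_maxnP exhi ubhi) => hi hhi maxhi.
exists lo, hi; split=> //.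
have h1 : 4 * #|[set x in B | f x < lo]| <= #|B|.
  case: lo hlo minlo => [|lo] hlo minlo.
    by rewrite (_ : [set x in B | _] = set0) ?cards0 //; apply/setP => x; rewrite !inE andbF.
  rewrite leqNgt; apply/negP => hh; suff : lo.+1 <= lo by rewrite ltnn.
  exact/minlo/ltnW.
have h2 : 4 * #|[set x in B | hi < f x]| <= #|B|.
  rewrite leqNgt; apply/negP => hh; suff : hi.+1 <= hi by rewrite ltnn.
  exact/maxhi/ltnW.
have : #|B| <= #|[set x in B | lo <= f x <= hi]| +
   (#|[set x in B | f x < lo]| + #|[set x in B | hi < f x]|).
  apply: (@leq_trans #|[set x in B | lo <= f x <= hi] :|:
    ([set x in B | f x < lo] :|: [set x in B | hi < f x])|).
    apply: subset_leq_card; apply/subsetP => x xB; rewrite !inE xB /=.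
    by case: ltnP => //=; case: ltnP.
  by rewrite (leq_trans (leq_card_setU _ _)) // leq_add2l leq_card_setU.
lia.
Qed.

Definition att (b : V) (A : {set V}) p := e b p && [forall a in A, (a != p) ==> ~~ e b a].
Definition good (A : {set V}) p (X : {set V}) := [set b in X | att b A p].

Lemma leq_card_bigcup (K : seq nat) (H : nat -> {set V}) (G : {set V}) :
  G \subset \bigcup_(k <- K) H k -> #|G| <= \sum_(k <- K) #|G :&: H k|.
Proof.
move=> /setIidPl hG; rewrite -{1}hG.
elim: K {hG} => [|k K IH]; first by rewrite !big_nil setI0 cards0.
by rewrite !big_cons setIUr (leq_trans (leq_card_setU _ _)) // leq_add2l.
Qed.

Lemma pigeon_sum (K : seq nat) (F : nat -> nat) n :
  0 < n -> n <= \sum_(k <- K) F k -> exists2 k, k \in K & n <= size K * F k.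
Proof.
move=> n0 hn; apply: contrapT => hno.
have hlt k : k \in K -> size K * F k < n.
  by move=> kK; rewrite ltnNge; apply/negP => h; apply: hno; exists k.
have : size K * \sum_(k <- K) F k <= \sum_(k <- K) n.-1.
  rewrite big_distrr /= big_seq [X in _ <= X]big_seq; apply: leq_sum => k /hlt; lia.
rewrite big_const_seq count_predT iter_addn_0.
by case: K hn {hno hlt} => [|k K] hn /=; [rewrite big_nil in hn; lia|nia].
Qed.

Section Process.
Variables (K : seq nat) (H : nat -> {set V}) (CP : bool -> {set V} -> V -> Prop).
Let hull := \bigcup_(k <- K) H k.
Hypothesis CP_mem : forall dl A p, CP dl A p -> p \in A.
Hypothesis CP_small : forall dl A p k, CP dl A p -> k \in K -> 8 * #|touched A (H k)| <= #|H k|.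
Hypothesis CP_ex : forall HH : {set V}, HH \subset hull ->
  (forall k, k \in K -> #|H k| <= 2 * #|HH :&: H k|) ->
  exists dl A p, [/\ CP dl A p, 0 < #|touched A HH| & #|touched A HH| <= 3 * #|good A p HH|].
Hypothesis K0 : 0 < size K.
Hypothesis Hpos : forall k, k \in K -> 0 < #|H k|.

Let sub_hull k : k \in K -> H k \subset hull.
Proof.
rewrite /hull; elim: K => // j K' IH; rewrite inE big_cons => /orP[/eqP->|/IH h].
  exact: subsetUl.
exact: subset_trans h (subsetUr _ _).
Qed.

(** While every block keeps two thirds of its vertices in HH, a candidate tree A is chosen,
    [touched A HH] is removed from HH, and its good vertices, at least a third of it, are collected
    in [G dl]. One removal costs a block at most an eighth, so all blocks still keep half when the
    first one falls below two thirds. *)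
Lemma process : exists k w dl (G HH : {set V}),
  [/\ k \in K, w \in K, G \subset H w, #|H k| <= 18 * size K * #|G|
    & (forall j, j \in K -> #|H j| <= 2 * #|HH :&: H j|) /\
      (forall b, b \in G -> exists A p, [/\ CP dl A p, att b A p & acomp A HH])].
Proof.
pose Inv (HH : {set V}) (G : bool -> {set V}) := [/\ HH \subset hull,
  #|hull| <= #|HH| + 3 * (#|G true| + #|G false|),
  forall dl, G dl \subset hull, forall dl, [disjoint G dl & HH]
  & forall dl b, b \in G dl -> exists A p, [/\ CP dl A p, att b A p & acomp A HH]].
have main N : forall (HH : {set V}) (G : bool -> {set V}), #|HH| < N -> Inv HH G ->
  (forall k, k \in K -> 2 * #|H k| <= 3 * #|HH :&: H k|) ->
  exists (HH : {set V}) (G : bool -> {set V}), Inv HH G /\ (forall k, k \in K -> #|H k| <= 2 * #|HH :&: H k|) /\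
   (exists2 k, k \in K & 3 * #|HH :&: H k| < 2 * #|H k|).
  elim: N => // N IH HH G hN [h1 h2 h3 h4 h5] h6.
  have h6' k : k \in K -> #|H k| <= 2 * #|HH :&: H k| by move/h6; lia.
  have [dl [A [p [cp t0 t3]]]] := CP_ex h1 h6'.
  pose HH' := HH :\: touched A HH.
  pose G' d := if d == dl then G d :|: good A p HH else G d.
  have gt : good A p HH \subset touched A HH.
    apply/subsetP => b; rewrite !inE => /andP[-> /andP[ebp _]] /=.
    by apply/existsP; exists p; rewrite (CP_mem cp) e_sym.
  have dG : [disjoint G dl & good A p HH].
    apply: disjointWr (h4 dl); apply: subset_trans gt (touched_sub _ _ _).
  have cHH : #|HH| = #|touched A HH| + #|HH'|.
    by rewrite -(cardsID (touched A HH) HH) (setIidPr (touched_sub _ _ _)).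
  have inv' : Inv HH' G'.
    split.
    - exact: subset_trans (subsetDl _ _) h1.
    - have : #|G dl :|: good A p HH| = #|G dl| + #|good A p HH|.
        by rewrite cardsU (disjoint_setI0 dG) cards0 subn0.
      rewrite /G' => hc; case: (dl) hc => /=; lia.
    - move=> d; rewrite /G'; case: eqP => _ //; rewrite subUset h3 /=.
      exact: subset_trans gt (subset_trans (touched_sub _ _ _) h1).
    - move=> d; rewrite /G' -setI_eq0; apply/eqP/setP => x; rewrite !inE.
      apply/negbTE/negP; case: eqP => [->|_].
        rewrite !inE => /and3P[/orP[xG|/andP[_ /andP[xp _]]] xt xHH].
          by have := disjointFr (h4 dl) xG; rewrite xHH.
        case/negP: xt; rewrite xHH.
        by apply/existsP; exists p; rewrite (CP_mem cp) e_sym.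
      by move=> /and3P[xG _ xHH]; have := disjointFr (h4 d) xG; rewrite xHH.
    - have sH : HH' \subset HH by apply: subsetDl.
      move=> d b; rewrite /G'; case: eqP => [->|_].
        rewrite !inE => /orP[/h5 [A' [p' [c1 c2 c3]]]|/andP[bH ba]].
          by exists A', p'; split=> // a x aA /(subsetP sH); apply: c3.
        exists A, p; split=> // a x aA; rewrite !inE => /andP[xt xH].
        apply/negP => eax; case/negP: xt; rewrite xH /=.
        by apply/existsP; exists a; rewrite aA.
      move=> /h5 [A' [p' [c1 c2 c3]]].
      by exists A', p'; split=> // a x aA /(subsetP sH); apply: c3.
  have loss k : k \in K -> #|HH :&: H k| <= #|HH' :&: H k| + #|touched A (H k)|.
    move=> kK; apply: leq_trans (leq_card_setU _ _); apply: subset_leq_card.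
    apply/subsetP => x; rewrite !inE => /andP[xH xk]; rewrite xH xk /= !andbT.
    by case: existsP.
  have h6'' k : k \in K -> #|H k| <= 2 * #|HH' :&: H k|.
    by move=> kK; have := loss k kK; have := h6 k kK; have := CP_small cp kK; lia.
  have [[k kK hk]|hno] := pselect (exists2 k, k \in K & 3 * #|HH' :&: H k| < 2 * #|H k|).
    by exists HH', G'; split=> //; split=> //; exists k.
  apply: (IH HH' G') => //; first by lia.
  by move=> k kK; rewrite leqNgt; apply/negP => h; apply: hno; exists k.
have [||HH [G [[h1 h2 h3 h4 h5] [h6 [k kK hk]]]]] := main _ hull (fun=> set0) (ltnSn _).
- split=> // [|dl|dl|dl b]; rewrite ?sub0set ?inE ?cards0 ?addn0 //.
  by rewrite -setI_eq0 set0I.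
- by move=> k kK; rewrite (setIidPr (sub_hull kK)); lia.
have cut : #|HH| + #|H k :\: HH| <= #|hull|.
  have <- : #|HH :|: (H k :\: HH)| = #|HH| + #|H k :\: HH|.
    rewrite cardsU (_ : _ :&: _ = set0) ?cards0 ?subn0 //.
    by apply/setP => x; rewrite !inE; case: (x \in HH).
  apply: subset_leq_card; rewrite subUset h1 /=.
  exact: subset_trans (subsetDl _ _) (sub_hull kK).
have := cardsID HH (H k); rewrite setIC => hID.
(* Block k lost more than a third of its vertices, at least a third of all removed vertices were
   collected, and these are split between two values of [dl]; hence 18. Choosing the block w then
   costs a factor [size K]. *)
have [dl hdl] : exists dl, #|H k| <= 18 * #|G dl|.
  have [hT|hF] := leqP #|G false| #|G true|; [exists true|exists false]; lia.
have Gpos : 0 < #|G dl| by have := Hpos kK; lia.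
have [w wK hw] := pigeon_sum Gpos (leq_card_bigcup (h3 dl)).
exists k, w, dl, (G dl :&: H w), HH; split=> //; first exact: subsetIr.
  by rewrite -mulnA (leq_trans hdl) // leq_mul2l.
by split=> // b; rewrite inE => /andP[bG _]; apply: (h5 dl).
Qed.

End Process.

(** * Trees of full branching *)

Variable h : nat.

Definition apart (X Y : {set V}) := [forall x in X, forall y in Y, (x != y) && ~~ e x y].

Definition child (A : {set V}) p (c : {set V} * V) :=
  [&& c.1 \subset A, p \notin c.1, c.2 \in c.1 & [forall x in c.1, e p x == (x == c.2)]].

Definition valid A p (cs : seq ({set V} * V)) :=
  all (child A p) cs && pairwise (fun c c' => apart c.1 c'.1) cs.

Fixpoint full r (A : {set V}) p : Prop :=
  if r is r'.+1 then p \in A /\ exists cs,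
    [/\ size cs = h, valid A p cs & forall c, c \in cs -> full r' c.1 c.2]
  else p \in A.

(* Interpolates between [full r] and [full r.+1] as v goes from r * h to r.+1 * h. *)
Definition ofull v A p := full (v %/ h) A p /\
  exists cs, [/\ size cs = v %% h, valid A p cs & forall c, c \in cs -> full (v %/ h) c.1 c.2].

Lemma full_mem r A p : full r A p -> p \in A.
Proof. by case: r => [|r] //= []. Qed.

Lemma valid_sub (A A' : {set V}) p cs : A \subset A' -> valid A p cs -> valid A' p cs.
Proof.
move=> hA /andP[h1 h2]; apply/andP; split=> //; apply: sub_all h1 => c /and4P[c1 c2 c3 c4].
by apply/and4P; split=> //; exact: subset_trans hA.
Qed.

Lemma full_sub r (A A' : {set V}) p : A \subset A' -> full r A p -> full r A' p.
Proof.
move=> hA; case: r => [|r] /=; first exact: (subsetP hA).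
case=> pA [cs [h1 h2 h3]]; split; first exact: (subsetP hA).
by exists cs; split=> //; apply: valid_sub h2.
Qed.

Lemma fullW r A p : full r.+1 A p -> full r A p.
Proof.
elim: r A p => [|r IH] A p; first by case.
move=> [pA [cs [h1 h2 h3]]]; split=> //; exists cs; split=> // c /h3; exact: IH.
Qed.

Lemma full_leq r r' A p : r <= r' -> full r' A p -> full r A p.
Proof.
move=> /subnK <-; elim: (r' - r) => [//|k IH]; rewrite addSn => /fullW; exact: IH.
Qed.

Lemma valid_take k A p cs : valid A p cs -> valid A p (take k cs).
Proof.
rewrite -{1}(cat_take_drop k cs) /valid all_cat pairwise_cat => /andP[/andP[-> _]].
by move=> /and3P[_ -> _].
Qed.

Hypothesis h0 : 0 < h.

(** Of the h branches at the root, v mod h + 1 are kept. If these are all of them, they make up the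
    next depth and the number of extra branches returns to 0. *)
Lemma full_ofullS v A p : full (v %/ h).+1 A p -> ofull v.+1 A p.
Proof.
move=> hf; have [pA [cs [h1 h2 h3]]] := hf.
have [hm|hm] := eqVneq (v %% h).+1 h.
  have vE : v.+1 = (v %/ h).+1 * h by rewrite {1}(divn_eq v h) -addnS hm mulSn addnC.
  by rewrite /ofull vE mulnK // modnMl; split=> //; exists [::].
have hlt : (v %% h).+1 < h by rewrite ltn_neqAle hm ltn_pmod.
have vE : v.+1 = (v %/ h) * h + (v %% h).+1 by rewrite {1}(divn_eq v h) addnS.
have vd : v.+1 %/ h = v %/ h by rewrite vE divnMDl // (divn_small hlt) addn0.
have vm : v.+1 %% h = (v %% h).+1 by rewrite vE modnMDl modn_small.
rewrite /ofull vd vm.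
split; first exact: fullW.
exists (take (v %% h).+1 cs); split.
- by rewrite size_takel ?h1 // ltnW.
- exact: valid_take.
- by move=> c /mem_take /h3.
Qed.

(** The new branch is apart from the old ones because those lie in A and avoid p. If it is the h-th
    extra branch, the depth rises by one. *)
Lemma ofull_addchild v (A A' : {set V}) p (c : {set V} * V) : ofull v A p -> A \subset A' -> child A' p c ->
  (forall x y, x \in A -> y \in c.1 -> x = p \/ (x != y) && ~~ e x y) ->
  full (v %/ h) c.1 c.2 -> ofull v.+1 A' p.
Proof.
move=> [hf [cs [h1 h2 h3]]] hA hc hap fc.
have hv : valid A' p (c :: cs).
  have /andP[v1 v2] := valid_sub hA h2; rewrite /valid /= hc v1 v2 /= andbT.
  apply/allP => c' c'cs; apply/forall_inP => y yc; apply/forall_inP => x xc'.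
  have /andP[/allP /(_ _ c'cs) /and4P[/subsetP sA pn _ _] _] := h2.
  rewrite eq_sym e_sym; case: (hap x y (sA _ xc') yc) => // xp.
  by rewrite -xp xc' in pn.
have hall c' : c' \in c :: cs -> full (v %/ h) c'.1 c'.2.
  by rewrite inE => /orP[/eqP->|/h3].
have [hm|hm] := eqVneq (v %% h).+1 h.
  have vE : v.+1 = (v %/ h).+1 * h by rewrite {1}(divn_eq v h) -addnS hm mulSn addnC.
  rewrite /ofull vE mulnK // modnMl; split; last by exists [::].
  split; first exact: (subsetP hA _ (full_mem hf)).
  by exists (c :: cs); split=> //=; rewrite h1.
have hlt : (v %% h).+1 < h by rewrite ltn_neqAle hm ltn_pmod.
have vE : v.+1 = (v %/ h) * h + (v %% h).+1 by rewrite {1}(divn_eq v h) addnS.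
have vd : v.+1 %/ h = v %/ h by rewrite vE divnMDl // (divn_small hlt) addn0.
have vm : v.+1 %% h = (v %% h).+1 by rewrite vE modnMDl modn_small.
rewrite /ofull vd vm.
by split; [exact: full_sub hf | exists (c :: cs); split=> //=; rewrite h1].
Qed.

End Attachment.

(* Adjacency in the tree on nat with root 0; the value [par 0] is irrelevant. *)
Definition te (par : nat -> nat) i j := (0 < j) && (par j == i) || (0 < i) && (par i == j).

Lemma teC par i j : te par i j = te par j i.
Proof. by rewrite /te orbC. Qed.

(** * Embedding a tree into one of full branching *)

Section TreeEmbedding.
Variables (V : finType) (e : rel V).
Hypothesis e_sym : symmetric e.
Hypothesis e_irr : irreflexive e.
Variables (m h : nat) (par : nat -> nat).
Hypothesis par_lt : forall v, 0 < v < m -> par v < v.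
Hypothesis mh : m <= h.

Lemma te_irr i : i < m -> te par i i = false.
Proof.
move=> im; apply/negbTE; rewrite /te orbb; apply/negP => /andP[i0 /eqP hi].
by have := par_lt (v := i); rewrite i0 im hi ltnn => /(_ isT).
Qed.

Let terr (p : V) (cs : seq ({set V} * V)) x := x = p \/ exists2 c, c \in cs & x \in c.1.

Let inv k := exists (f : nat -> V) (cs : nat -> seq ({set V} * V)) (A : nat -> {set V}),
  [/\ forall i, i < k -> valid e (A i) (f i) (cs i),
      forall i, i < k -> m - k <= size (cs i),
      forall i c, i < k -> c \in cs i -> full e h (m - k) c.1 c.2,
      forall i j x y, i < k -> j < k -> i != j -> terr (f i) (cs i) x -> terr (f j) (cs j) y ->
        x != y /\ (e x y -> x = f i /\ y = f j)
    & forall i j, i < k -> j < k -> e (f i) (f j) = te par i j].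

Let invS k : 0 < k < m -> inv k -> inv k.+1.
Proof.
move=> /andP[k0 km] [f [cs [A [h1 h2 h3 h4 h5]]]].
have qk : par k < k by apply: par_lt; rewrite k0.
set q := par k in qk *.
have hsz : 0 < size (cs q) by have := h2 q qk; lia.
case E : (cs q) hsz => [//|c cq] _.
have hc : c \in cs q by rewrite E mem_head.
have := h3 q c qk hc; rewrite (_ : m - k = (m - k.+1).+1); last by lia.
case=> cc [csk [k1 k2 k3]].
have /andP[vq1 vq2] := h1 q qk.
rewrite E /= in vq1 vq2; case/andP: vq1 => chc vq1; case/andP: vq2 => /allP apc vq2.
have /and4P[_ fqn _ /forall_inP ec] := chc.
pose f' i := if i == k then c.2 else f i.
pose cs' i := if i == k then csk else if i == q then cq else cs i.
pose A' i := if i == k then c.1 else A i.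
have T1 i x : i < k -> terr (f' i) (cs' i) x -> terr (f i) (cs i) x.
  move=> ik; rewrite /f' /cs' (ltn_eqF ik); case: eqP => [->|_] //.
  by case=> [->|[c' c'q xc]]; [left|right; exists c' => //; rewrite E inE c'q orbT].
have T2 y : terr (f' k) (cs' k) y -> y \in c.1.
  rewrite /f' /cs' eqxx => -[->//|[c' c'k yc]].
  have /andP[/allP /(_ _ c'k) /and4P[/subsetP sA _ _ _] _] := k2; exact: sA.
have sep i x y : i < k -> terr (f' i) (cs' i) x -> y \in c.1 ->
    x != y /\ (e x y -> x = f' i /\ y = c.2).
  move=> ik tx yc; have ty : terr (f q) (cs q) y by right; exists c.
  have [iq|iq] := eqVneq i q; last first.
    have [xy exy] := h4 i q x y ik qk iq (T1 _ _ ik tx) ty.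
    by split=> // /exy [_ yf]; rewrite -yf yc in fqn.
  move: tx; rewrite /f' /cs' (ltn_eqF ik) iq eqxx => -[->|[c' c'q xc]].
    split; first by apply: contraNneq fqn => ->.
    by rewrite (eqP (ec y yc)) => /eqP.
  have /forall_inP /(_ y yc) /forall_inP /(_ x xc) := apc _ c'q.
  by rewrite eq_sym e_sym => /andP[-> /negbTE ->].
have ek i : i < k -> e (f i) c.2 = te par i k.
  move=> ik; have tf : terr (f' i) (cs' i) (f i) by left; rewrite /f' (ltn_eqF ik).
  have -> : te par i k = (i == q).
    rewrite /te k0 /= -/q (eq_sym q); case: (i == q) => //=.
    apply/negbTE/negP => /andP[i0 /eqP hp].
    have : par i < i by apply: par_lt; rewrite i0; lia.
    by rewrite hp; lia.
  have [iq|iq] := eqVneq i q; first by rewrite iq (eqP (ec _ cc)) eqxx.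
  have ty : terr (f q) (cs q) c.2 by right; exists c.
  have [_ exy] := h4 i q _ _ ik qk iq (T1 _ _ ik tf) ty.
  by apply/negbTE/negP => /exy [_ yf]; rewrite -yf cc in fqn.
exists f', cs', A'; split.
- move=> i; rewrite ltnS leq_eqVlt => /orP[/eqP->|ik].
    by rewrite /f' /cs' /A' eqxx.
  rewrite /f' /cs' /A' (ltn_eqF ik); case: eqP => [->|_]; last exact: h1.
  by rewrite /valid vq1.
- move=> i; rewrite ltnS leq_eqVlt => /orP[/eqP->|ik].
    by rewrite /cs' eqxx k1; lia.
  rewrite /cs' (ltn_eqF ik); case: eqP => [_|_]; last by have := h2 i ik; lia.
  by have := h2 q qk; rewrite E /=; lia.
- move=> i c'; rewrite ltnS leq_eqVlt => /orP[/eqP->|ik].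
    by rewrite /cs' eqxx; exact: k3.
  rewrite /cs' (ltn_eqF ik) => hc'; apply: (@full_leq _ _ _ _ (m - k)); first by lia.
  apply: (h3 i) => //; move: hc'; case: eqP => [->|//].
  by rewrite E inE => ->; rewrite orbT.
- move=> i j x y; rewrite !ltnS leq_eqVlt => /orP[/eqP->|ik].
    rewrite leq_eqVlt => /orP[/eqP->|jk]; first by rewrite eqxx.
    move=> _ /T2 tx ty; have [xy exy] := sep j y x jk ty tx.
    rewrite eq_sym; split=> //; rewrite e_sym => /exy [-> ->].
    by split=> //; rewrite /f' eqxx.
  rewrite leq_eqVlt => /orP[/eqP->|jk] ij tx.
    move=> /T2 ty; have [xy exy] := sep i x y ik tx ty; split=> // /exy [-> ->].
    by split=> //; rewrite /f' eqxx.
  move=> ty; have := h4 i j x y ik jk ij (T1 _ _ ik tx) (T1 _ _ jk ty).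
  by rewrite /f' (ltn_eqF ik) (ltn_eqF jk).
- move=> i j; rewrite !ltnS leq_eqVlt => /orP[/eqP->|ik].
    rewrite leq_eqVlt => /orP[/eqP->|jk]; first by rewrite e_irr te_irr.
    by rewrite /f' eqxx (ltn_eqF jk) e_sym teC ek.
  rewrite leq_eqVlt => /orP[/eqP->|jk]; first by rewrite /f' eqxx (ltn_eqF ik) ek.
  by rewrite /f' (ltn_eqF ik) (ltn_eqF jk) h5.
Qed.

Lemma full_tree A p : 0 < m -> full e h m A p ->
  exists f : nat -> V, forall i j, i < m -> j < m ->
    (i != j -> f i != f j) /\ e (f i) (f j) = te par i j.
Proof.
move=> m0 fu.
have : inv m.
  have i1 : inv 1.
    move: fu; rewrite -{1}(prednK m0) => -[pA [cs [c1 c2 c3]]].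
    exists (fun=> p), (fun=> cs), (fun=> A); split=> //.
    - by move=> i _; rewrite c1; lia.
    - by move=> i c _ /c3; rewrite subn1.
    - by move=> i j x y; rewrite !ltnS !leqn0 => /eqP-> /eqP->; rewrite eqxx.
    - move=> i j; rewrite !ltnS !leqn0 => /eqP-> /eqP->.
      by rewrite e_irr te_irr.
  have : forall k, 0 < k <= m -> inv k.
    elim=> [//|[|k] IH] hk //.
    by apply: invS; [|apply: IH]; lia.
  by apply; rewrite m0 leqnn.
case=> f [cs [A' [_ _ _ h4 h5]]]; exists f => i j im jm; split; last exact: h5.
move=> ij; have [||//] := h4 i j (f i) (f j) im jm ij; by left.
Qed.

End TreeEmbedding.

(** * Forests as induced subgraphs of rooted trees *)

Section Forest.
Variable T : sgraph.
Hypothesis forestT : forest T.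

(** Otherwise every vertex of S has a neighbour in S other than any prescribed vertex, so a path in
    S can be continued without turning back. As T is finite, it must run into itself, and this
    closes a cycle. *)
Lemma forest_leaf (S : {set T}) x0 : x0 \in S ->
  exists2 x, x \in S & forall y z, y \in S -> z \in S -> adj x y -> adj x z -> y = z.
Proof.
move=> x0S; apply: contrapT => hno.
have two x a : x \in S -> exists y, [/\ y \in S, adj x y & y != a].
  move=> xS; apply: contrapT => hn; apply: hno; exists x => // y z yS zS xy xz.
  have eqa u : u \in S -> adj x u -> u = a.
    by move=> uS xu; apply/eqP/negPn/negP => ua; apply: hn; exists u.
  by rewrite (eqa y) // (eqa z).
suff ext n x p : uniq (x :: p) -> path (@adj T) x p -> all (mem S) (x :: p) ->
    #|T| < n + size p -> False.
  by apply: (ext #|T|.+1 x0 [::]) => //=; rewrite ?x0S // addn0.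
elim: n x p => [|n IH] x p up pp ap hn.
  move: (max_card (mem (x :: p))) hn; rewrite (card_uniqP up) add0n /= => h1 h2.
  by have := leq_trans h1 (ltnW h2); rewrite ltnn.
have xS : x \in S by have /andP[] := ap.
(* [head x p] is the previous vertex on the path; for a path of one vertex the default x excludes
   nothing, x not being adjacent to itself. *)
have [y [yS xy ya]] := two x (head x p) xS.
have [yp|yp] := boolP (y \in x :: p); last first.
  apply: (IH y (x :: p)).
  - by rewrite cons_uniq yp.
  - by rewrite /= adj_sym xy.
  - by move: ap => /= ->; rewrite andbT.
  - by rewrite /= addnS -addSn.
have yx : y != x by apply: contraTneq xy => ->; rewrite adj_irr.
move: yp; rewrite inE (negbTE yx) /=.
case: p ya up pp {ap hn} => [//|a p] /= ya up pp; rewrite inE (negbTE ya) /= => yp.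
case/splitPr: yp up pp => p1 p2 up pp; apply: forestT.
exists (x :: rcons (a :: p1) y); split.
- by rewrite /= size_rcons.
- apply: (@subseq_uniq _ _ (x :: a :: p1 ++ y :: p2)); last exact: up.
  rewrite -[x :: a :: _]/((x :: a :: p1) ++ y :: p2) -cat_rcons.
  exact: prefix_subseq.
- rewrite /cycle rcons_path last_rcons adj_sym xy andbT.
  by move: pp; rewrite /= cat_path /= rcons_path => /and3P[-> -> /andP[-> _]].
Qed.

(** A vertex with at most one neighbour is removed and, after numbering the rest, gets the last
    number, with that neighbour as its parent. *)
Lemma forest_te : exists (m : nat) (par : nat -> nat) (g : T -> nat),
  [/\ 0 < m, forall v, 0 < v < m -> par v < v, injective g, forall x, g x < m
    & forall x y, adj x y = te par (g x) (g y)].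
Proof.
(* The number 0 is kept out of the image of g: it is an extra root, the parent of vertices without a
   neighbour among those numbered earlier. *)
suff [m [par [g [h1 h2 h3 h4 h5]]]] : exists (m : nat) (par : nat -> nat) (g : T -> nat),
  [/\ 0 < m, forall v, 0 < v < m -> par v < v, {in [set: T] &, injective g},
    {in [set: T], forall x, 0 < g x < m}
    & {in [set: T] &, forall x y, adj x y = te par (g x) (g y)}].
  exists m, par, g; split=> // [x y hxy|x|x y]; [apply: h3 => //|by case/andP: (h4 x (in_setT x))|].
  exact: h5.
have [n] := ubnP #|[set: T]|; elim: n [set: T] => // n IH S hS.
have [S0|[x0 x0S]] := set_0Vmem S.
  rewrite S0; exists 1, (fun=> 0), (fun=> 0); split=> //.
  - by case.
  - by move=> x y; rewrite inE.
  - by move=> x; rewrite inE.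
  - by move=> x y; rewrite inE.
have [x xS leaf] := forest_leaf x0S.
have [|m [par [g [h1 h2 h3 h4 h5]]]] := IH (S :\ x).
  by have := cardsD1 x S; rewrite xS; lia.
have inSx z : z \in S -> z != x -> z \in S :\ x by rewrite !inE => -> ->.
pose q := if [pick y in S | adj x y] is Some y then g y else 0.
have qm : q < m.
  rewrite /q; case: pickP => [y /andP[yS xy]|//].
  have yx : y != x by apply: contraTneq xy => ->; rewrite adj_irr.
  by case/andP: (h4 y (inSx _ yS yx)).
have qE y : y \in S -> y != x -> (q == g y) = adj x y.
  move=> yS yx; have /andP[gy0 _] := h4 y (inSx _ yS yx).
  rewrite /q; case: pickP => [z /andP[zS xz]|hn].
    have zx : z != x by apply: contraTneq xz => ->; rewrite adj_irr.
    rewrite (inj_in_eq h3) ?inSx //; apply/eqP/idP => [<-//|xy].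
    exact: leaf.
  by have := hn y; rewrite yS /= => ->; apply/negbTE; rewrite neq_ltn gy0.
pose par' v := if v == m then q else par v.
pose g' z := if z == x then m else g z.
exists m.+1, par', g'; split=> //.
- move=> v /andP[v0]; rewrite ltnS leq_eqVlt /par' => /orP[/eqP->|vm]; first by rewrite eqxx.
  by rewrite (ltn_eqF vm) h2 // v0.
- move=> y z yS zS; rewrite /g'; case: eqVneq => [->|yx]; case: eqVneq => [->|zx] // hg.
  + by have := h4 z (inSx _ zS zx); rewrite -hg ltnn andbF.
  + by have := h4 y (inSx _ yS yx); rewrite hg ltnn andbF.
  + by apply: h3 hg; apply: inSx.
- move=> y yS; rewrite /g'; case: eqVneq => [_|yx]; first by rewrite h1 /=.
  by have /andP[-> /ltnW] := h4 y (inSx _ yS yx).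
have teq y : y \in S -> y != x -> te par' (g y) m = adj x y.
  move=> yS yx; have /andP[g0 gm] := h4 y (inSx _ yS yx).
  rewrite /te /par' h1 eqxx g0 (ltn_eqF gm) /= qE //; case: (adj x y) => //=.
  have := h2 (g y); rewrite g0 gm => /(_ isT) pl.
  by apply/negbTE; rewrite neq_ltn; apply/orP; left; apply: ltn_trans pl gm.
move=> y z yS zS; rewrite /g'; case: eqVneq => [->|yx]; case: eqVneq => [->|zx].
- by rewrite adj_irr /te /par' eqxx h1 /= orbb (ltn_eqF qm).
- by rewrite teC teq.
- by rewrite adj_sym teq.
- rewrite (h5 y z); try exact: inSx.
  have /andP[_ gy] := h4 y (inSx _ yS yx); have /andP[_ gz] := h4 z (inSx _ zS zx).
  by rewrite /te /par' (ltn_eqF gy) (ltn_eqF gz).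
Qed.

End Forest.

Lemma embedding_not_free (T G : sgraph) (f : T -> G) : injective f ->
  (forall x y, adj (f x) (f y) = adj x y) -> ~ free_of T G.
Proof.
move=> finj fadj; move/(_ [set y in codom f]); apply.
have inv (z : induced [set y in codom f]) : val z \in codom f.
  by have := valP z; rewrite inE.
exists (fun z => iinv (inv z)); last first.
  by move=> x y; rewrite -fadj !f_iinv.
have fS x : f x \in [set y in codom f] by rewrite inE codom_f.
exists (fun x => exist _ (f x) (fS x)).
- by move=> z; apply: val_inj => /=; rewrite f_iinv.
- by move=> x; apply: finj; rewrite f_iinv.
Qed.

Lemma leq_card_bigcup_in (I V : finType) (Q : {set I}) (F : I -> {set V}) :
  #|\bigcup_(x in Q) F x| <= \sum_(x in Q) #|F x|.
Proof.
elim/big_rec2: _ => [|x s A _ h]; first by rewrite cards0.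
by rewrite (leq_trans (leq_card_setU _ _)) // leq_add2l.
Qed.

(** * Splitting a set sparsely *)

Section SparseSplit.
Variables (V : finType) (e : rel V).
Hypothesis e_sym : symmetric e.
Hypothesis e_irr : irreflexive e.

Lemma markov (A : {set V}) (f : V -> nat) :
  #|A| <= 2 * #|[set v in A | #|A| * f v <= 2 * \sum_(u in A) f u]|.
Proof.
set A1 := [set v in A | _]; set s := \sum_(u in A) f u.
have hA := cardsID A1 A; rewrite (setIidPr (_ : A1 \subset A)) in hA; last first.
  by apply/subsetP => x; rewrite inE => /andP[].
have : #|A :\: A1| * (2 * s).+1 <= #|A| * s.
  apply: (@leq_trans (\sum_(v in A :\: A1) #|A| * f v)).
    rewrite -sum_nat_const; apply: leq_sum => v; rewrite !inE => /andP[hv vA].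
    by move: hv; rewrite vA /= -ltnNge.
  rewrite -big_distrr leq_mul2l /s; apply/orP; right.
  by rewrite [X in _ <= X](big_setID A1) /= leq_addl.
nia.
Qed.

Definition nonnb (S : {set V}) x := [set y in S | ~~ e x y].

(** Take a largest clique Q inside D. If it had at most w vertices, their non-neighbourhoods would
    cover at most an eighth of S, so some vertex of D, which exceeds half of S, would be adjacent to
    all of Q and extend it. *)
Lemma clique_of_few_nonnb (S D : {set V}) w : D \subset S -> #|S| < 2 * #|D| ->
  (forall x, x \in D -> 8 * w * #|nonnb S x| < #|S|) ->
  exists Q : {set V}, (forall x y, x \in Q -> y \in Q -> x != y -> e x y) /\ w < #|Q|.
Proof.
move=> DS hD hx.
pose cl (Q : {set V}) := (Q \subset D) &&
  [forall x in Q, forall y in Q, (x != y) ==> e x y].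
have cl0 : cl set0 by rewrite /cl sub0set; apply/forall_inP => x; rewrite inE.
case: (arg_maxnP (fun Q : {set V} => #|Q|) cl0) => Q /andP[QD /forall_inP hQ] Qmax.
exists Q; split.
  by move=> x y xQ yQ; have /forall_inP /(_ y yQ) /implyP := hQ x xQ.
rewrite ltnNge; apply/negP => Qw.
have [y yD yQ] : exists2 y, y \in D & forall x, x \in Q -> e x y.
  apply: contrapT => hno.
  have sub : D \subset \bigcup_(x in Q) nonnb S x.
    apply/subsetP => y yD; apply/bigcupP; apply: contrapT => hn.
    apply: hno; exists y => // x xQ; apply/negPn/negP => exy; apply: hn; exists x => //.
    by rewrite inE (subsetP DS).
  have := leq_trans (subset_leq_card sub) (leq_card_bigcup_in _ _).
  have : 8 * w * \sum_(x in Q) #|nonnb S x| <= #|Q| * #|S|.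
    rewrite -sum_nat_const big_distrr /=; apply: leq_sum => x xQ.
    exact/ltnW/hx/(subsetP QD).
  have [w0|wp] := posnP w.
    move: Qw; rewrite w0 leqn0 => /eqP /cards0_eq ->; rewrite big_set0 => _; lia.
  move=> h1 h2.
  have h3 : 8 * w * \sum_(x in Q) #|nonnb S x| <= w * #|S|.
    by apply: leq_trans h1 _; rewrite leq_mul2r Qw orbT.
  move: h3; rewrite [8 * w]mulnC -mulnA leq_pmul2l //; lia.
have ynQ : y \notin Q by apply/negP => /yQ; rewrite e_irr.
have : cl (y |: Q).
  rewrite /cl subUset sub1set yD QD /=; apply/forall_inP => a; rewrite !inE => ha.
  apply/forall_inP => b; rewrite !inE => hb; apply/implyP => ab.
  case/orP: ha hb ab => [/eqP->|aQ]; case/orP => [/eqP->|bQ] ab; rewrite ?eqxx // in ab *.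
  - by rewrite e_sym yQ.
  - exact: yQ.
  - by have /forall_inP /(_ b bQ) /implyP /(_ ab) := hQ a aQ.
by move/Qmax; rewrite cardsU1 ynQ; lia.
Qed.

Variable par : nat -> nat.

Definition emb k (S : {set V}) : {set {ffun 'I_k -> V}} :=
  [set f : {ffun 'I_k -> V} | [forall i, f i \in S] &&
    [forall i, forall j, ((i != j) ==> (f i != f j)) && (e (f i) (f j) == te par i j)]].

Lemma embP k (S : {set V}) (f : {ffun 'I_k -> V}) :
  reflect ((forall i, f i \in S) /\
    forall i j, (i != j -> f i != f j) /\ e (f i) (f j) = te par i j) (f \in emb k S).
Proof.
rewrite inE; apply: (iffP andP) => -[h1 h2]; split.
- exact/forallP.
- by move=> i j; have /forallP /(_ i) /forallP /(_ j) /andP[/implyP h3 /eqP] := h2.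
- exact/forallP.
- apply/forallP => i; apply/forallP => j; have [h3 ->] := h2 i j.
  by rewrite eqxx andbT; apply/implyP.
Qed.

Section Count.
Variables (k : nat) (p : 'I_k) (S : {set V}).
Hypothesis park : par k = p.
Hypothesis par_lt : forall i, 0 < i < k -> par i < i.

Definition upd (f : {ffun 'I_k -> V}) v : {ffun 'I_k -> V} :=
  [ffun i => if i == p then v else f i].
Definition ext (f : {ffun 'I_k -> V}) x : {ffun 'I_k.+1 -> V} :=
  [ffun i => if unlift ord_max i is Some j then f j else x].
(** [away f] and [roots f] do not depend on the value of f at p. An edge from v in [roots f] to x in
    [away f] gives the copy [ext (upd f v) x] of the first k + 1 tree vertices. Averages are taken
    over all maps into S instead of maps defined off p, which multiplies the counts by #|S|. *)
Definition away (f : {ffun 'I_k -> V}) :=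
  [set x in S | [forall i, (i != p) ==> (x != f i) && ~~ e x (f i)]].
Definition roots f := [set v | upd f v \in emb k S].

Definition maps := [set f : {ffun 'I_k -> V} | [forall i, f i \in S]].

Let card_maps : #|maps| = #|S| ^ k.
Proof.
have := card_ffun_on 'I_k (mem S); rewrite card_ord => <-; apply: eq_card => f.
by rewrite inE; apply/forallP/ffun_onP.
Qed.

(** Exchanges the value at p with the separate vertex; used to reindex sums over pairs of a map and
    a vertex. *)
Let phi (x : {ffun 'I_k -> V} * V) := (upd x.1 x.2, x.1 p).

Let phiK : involutive phi.
Proof.
case=> f v; rewrite /phi /= !ffunE eqxx; congr (_, _).
by apply/ffunP => i; rewrite !ffunE; case: eqP => [->|].
Qed.

Let sum_upd (G : {ffun 'I_k -> V} -> nat) :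
  \sum_(f in maps) \sum_(v in S) G (upd f v) = #|S| * \sum_(f in maps) G f.
Proof.
rewrite pair_big /= (reindex_inj (can_inj phiK)) /=.
transitivity (\sum_(fv : {ffun 'I_k -> V} * V | (fv.1 \in maps) && (fv.2 \in S)) G fv.1).
  apply: eq_big => [[f v]|[f v] _] /=; last first.
    by congr G; have [-> _] := phiK (f, v).
  rewrite !inE /=; apply/andP/andP => -[/forallP h1 h2]; split.
  - apply/forallP => i; have := h1 i; rewrite ffunE; case: eqP => // -> _; exact: h2.
  - by have := h1 p; rewrite ffunE eqxx.
  - by apply/forallP => i; rewrite ffunE; case: eqP.
  - exact: h1.
rewrite -(pair_big (mem maps) (mem S) (fun f _ => G f)) /= big_distrr /=.
by apply: eq_bigr => f _; rewrite sum_nat_const.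
Qed.

Let away_upd f v : away (upd f v) = away f.
Proof.
apply/setP => x; rewrite !inE; congr (_ && _); apply: eq_forallb => i.
by rewrite ffunE; case: eqP.
Qed.

Let sum_roots (g : V -> {set V} -> nat) : 
  \sum_(f in maps) \sum_(v in roots f) g v (away f) =
  #|S| * \sum_(f in emb k S) g (f p) (away f).
Proof.
have -> : \sum_(f in emb k S) g (f p) (away f) =
   \sum_(f in maps) (if f \in emb k S then g (f p) (away f) else 0).
  rewrite -big_mkcondr /=; apply: eq_bigl => f.
  by case: embP => [[h1 _]|_]; rewrite ?andbF // andbT !inE; symmetry; apply/forallP.
rewrite -sum_upd; apply: eq_bigr => f _; rewrite -big_mkcondr /=.
apply: eq_big => [v|v _]; last by rewrite away_upd ffunE eqxx.
rewrite inE; case: embP => [[h1 _]|_]; rewrite ?andbF // andbT; symmetry.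
by have := h1 p; rewrite ffunE eqxx.
Qed.

Lemma sum_edges_ext :
  \sum_(f in maps) \sum_(v in roots f) #|nb e v (away f)| <= #|S| * #|emb k.+1 S|.
Proof.
rewrite (sum_roots (fun v X => #|nb e v X|)) leq_mul2l; apply/orP; right.
under eq_bigr => f _ do rewrite -sum1_card.
rewrite pair_big_dep /= sum1dep_card.
rewrite -(@card_in_imset _ _ (fun fx : {ffun 'I_k -> V} * V => ext fx.1 fx.2)); last first.
  move=> [f x] [g y] _ _ /= hfg.
  have := congr1 (fun F : {ffun 'I_k.+1 -> V} => F ord_max) hfg.
  rewrite !ffunE unlift_none => ->; congr (_, _).
  apply/ffunP => i; have := congr1 (fun F : {ffun 'I_k.+1 -> V} => F (lift ord_max i)) hfg.
  by rewrite !ffunE liftK.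
apply: subset_leq_card; apply/subsetP => F /imsetP[[f x] hfx ->].
move: hfx; rewrite [(f, x) \in _]inE /= => /andP[/embP[h1 h2]].
rewrite [x \in _]inE [x \in away _]inE => /andP[/andP[xS /forallP hx] epx].
have val_lift (i : 'I_k) : nat_of_ord (lift ord_max i) = i by rewrite lift_max.
have xf i : (x != f i) /\ e x (f i) = te par k i.
  have k0 : 0 < k := leq_ltn_trans (leq0n _) (ltn_ord i).
  have -> : te par k i = (i == p).
    rewrite /te k0 park (eq_sym (nat_of_ord p)) /= -(inj_eq val_inj) /=.
    apply: orb_idl => /andP[i0 /eqP hi].
    have : par i < i by apply: par_lt; rewrite i0 ltn_ord.
    by rewrite hi; have := ltn_ord i; lia.
  have [->|ip] := eqVneq i p.
    by rewrite e_sym epx; split=> //; apply: contraTneq epx => ->; rewrite e_irr.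
  by have := hx i; rewrite ip => /andP[-> /negbTE ->].
apply/embP; split=> [i|i j]; rewrite !ffunE.
  by case: unliftP => [i' _|_].
case: unliftP => [i' ->|->]; case: unliftP => [j' ->|->].
- rewrite !val_lift; have [h3 h4] := h2 i' j'; split=> //.
  by move=> hij; apply: h3; apply: contraNneq hij => ->.
- by have [h3 h4] := xf i'; rewrite val_lift e_sym teC h4 (eq_sym (f i')) h3.
- by have [h3 h4] := xf j'; rewrite val_lift h4 h3.
- rewrite eqxx e_irr; split=> //; symmetry; apply/negbTE; rewrite /te orbb.
  by rewrite park; apply/negP => /andP[_ /eqP /= hk]; have := ltn_ord p; rewrite hk ltnn.
Qed.

(** A copy f that lies in [nonnb S x :\ x] has x in [away f], so the left sum counts pairs that the
    right one counts too. *)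
Lemma sum_nonnb_emb : #|S| * \sum_(x in S) #|emb k (nonnb S x :\ x)| <=
  \sum_(f in maps) #|roots f| * #|away f|.
Proof.
have -> : \sum_(f in maps) #|roots f| * #|away f| =
   \sum_(f in maps) \sum_(v in roots f) #|away f|.
  by apply: eq_bigr => f _; rewrite sum_nat_const.
rewrite (sum_roots (fun _ X => #|X|)) leq_mul2l; apply/orP; right.
under eq_bigr => x _ do rewrite -sum1_card big_mkcond /=.
rewrite exchange_big /= [X in _ <= X]big_mkcond /=; apply: leq_sum => f _.
rewrite -big_mkcondr /= sum1dep_card.
case: (boolP (f \in emb k S)) => fS; last first.
  rewrite leqn0 cards_eq0; apply/eqP/setP => x; rewrite in_set0 inE.
  apply/negbTE/negP => /andP[xS /embP[h1 h2]]; case/negP: fS; apply/embP; split=> // i.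
  by have := h1 i; rewrite !inE => /and3P[].
apply: subset_leq_card; apply/subsetP => x; rewrite [x \in [set _ | _]]inE => /andP[xS /embP[h1 _]].
rewrite inE xS; apply/forallP => i; apply/implyP => _.
by have := h1 i; rewrite !inE eq_sym => /and3P[-> _ ->].
Qed.

(** At least half of the vertices have many non-neighbours, hence many copies of the first k tree
    vertices among these. So the product of the sizes of [roots f] and [away f] is large on average,
    while few edges join the two sets, each edge giving a copy of the first k + 1 vertices. For a
    suitable f the two sets are large with few edges between them, and they are trimmed to be
    disjoint with small degrees. *)
Lemma sparse_split w q c : 1 < w ->
  (forall Q : {set V}, (forall x y, x \in Q -> y \in Q -> x != y -> e x y) -> #|Q| <= w) ->
  (forall S' : {set V}, S' \subset S -> #|S| <= 16 * w * #|S'| ->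
     #|S'| ^ k <= w ^ q * #|emb k S'|) ->
  w ^ (5 * k + q + 3) <= #|S| ->
  w ^ (3 * (5 * k + q + 2) + c + 5) * #|emb k.+1 S| <= #|S| ^ k.+1 ->
  exists A B : {set V}, [/\ A \subset S, B \subset S, [disjoint A & B],
    #|S| <= w ^ (5 * k + q + 5) * #|A| /\ #|S| <= w ^ (5 * k + q + 5) * #|B|
    & (forall v, v \in A -> w ^ c * #|nb e v B| <= #|B|) /\
      (forall v, v \in B -> w ^ c * #|nb e v A| <= #|A|)].
Proof.
move=> w1 hcl hdense hN hsp; have w0 : 0 < w by apply: ltnW.
have wX a : 0 < w ^ a by rewrite expn_gt0 w0.
have wS a : 2 * w ^ a <= w ^ a.+1 by rewrite expnS leq_mul2r w1 orbT.
set N := #|S| in hN hsp hdense *.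
have k0 : 0 < k := leq_ltn_trans (leq0n _) (ltn_ord p).
have w4 : 16 <= w ^ 4 by apply: (@leq_trans (2 ^ 4)) => //; rewrite leq_exp2r.
have w5 : 16 * w <= w ^ 5 by rewrite expnSr leq_mul2r w4 orbT.
have hN5 : 16 * w <= N.
  by apply: leq_trans w5 (leq_trans _ hN); rewrite leq_exp2l //; lia.
have N0 : 0 < N by apply: leq_trans hN.
pose D := [set x in S | 8 * w * #|nonnb S x| < N].
have DS : D \subset S by apply/subsetP => x; rewrite inE => /andP[].
have hD : 2 * #|D| <= N.
  rewrite leqNgt; apply/negP => hD.
  have [Q [Qcl wQ]] : exists Q : {set V},
     (forall x y, x \in Q -> y \in Q -> x != y -> e x y) /\ w < #|Q|.
    by apply: (clique_of_few_nonnb DS hD) => x; rewrite inE => /andP[].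
  by have := hcl Q Qcl; lia.
(* Such an x has at least N / (8w) non-neighbours. Doubling 8 to 16 pays for deleting x, and
   [16 * w] is at most [w ^ 5]. *)
have hx x : x \in S :\: D -> N ^ k <= w ^ (5 * k + q) * #|emb k (nonnb S x :\ x)|.
  rewrite !inE => /andP[]; case xS : (x \in S) => //=; rewrite -leqNgt => hx _.
  have xM : x \in nonnb S x by rewrite inE xS e_irr.
  have hM := cardsD1 x (nonnb S x); rewrite xM add1n in hM.
  have hM2 : N <= 16 * w * #|nonnb S x :\ x| by move: hx hN5; rewrite hM; nia.
  have MS : nonnb S x :\ x \subset S.
    by apply: subset_trans (subsetDl _ _) _; apply/subsetP => y; rewrite inE => /andP[].
  have := hdense _ MS hM2; rewrite expnD -mulnA => hd.
  apply: (@leq_trans ((w ^ 5 * #|nonnb S x :\ x|) ^ k)).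
    by rewrite leq_exp2r // (leq_trans hM2) // leq_mul2r w5 orbT.
  by rewrite expnMn -expnM leq_mul2l hd orbT.
set tot := \sum_(f in maps) #|roots f| * #|away f|.
set edg := \sum_(f in maps) \sum_(v in roots f) #|nb e v (away f)|.
have htot : N ^ k.+2 <= w ^ (5 * k + q + 1) * tot.
  have hsum : N * N ^ k <= 2 * (w ^ (5 * k + q) * \sum_(x in S) #|emb k (nonnb S x :\ x)|).
    apply: (@leq_trans (2 * (#|S :\: D| * N ^ k))).
      rewrite mulnA leq_mul2r; apply/orP; right.
      by have := cardsID D S; rewrite (setIidPr DS) -/N; lia.
    rewrite leq_mul2l /= -sum_nat_const (leq_trans (leq_sum _ hx)) //.
    by rewrite -big_distrr leq_mul2l /= [X in _ <= X](big_setID D) /= leq_addl orbT.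
  have := sum_nonnb_emb; rewrite -/tot -/N; move: hsum.
  set sg := \sum_(x in S) _ => hsum htt.
  rewrite !expnS (leq_trans (_ : _ <= N * (2 * (w ^ (5 * k + q) * sg)))) //.
    by rewrite leq_mul2l hsum orbT.
  rewrite addn1 (leq_trans (_ : _ <= 2 * w ^ (5 * k + q) * tot)) ?leq_mul2r ?wS ?orbT //.
  by rewrite -mulnA mulnCA leq_mul2l /= mulnCA leq_mul2l htt orbT.
set a1 := 5 * k + q + 2 in hsp *; set c' := c + 2 * a1 + 5.
have hedg : w ^ (a1 + c') * edg <= N ^ k.+2.
  have := sum_edges_ext; rewrite -/edg -/N => he.
  rewrite (leq_trans (_ : _ <= w ^ (a1 + c') * (N * #|emb k.+1 S|))) ?leq_mul2l ?he ?orbT //.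
  rewrite mulnCA [N ^ k.+2]expnS leq_mul2l; apply/orP; right.
  by rewrite (_ : a1 + c' = 3 * a1 + c + 5) //; rewrite /c'; lia.
(* If each map failed one of the bounds, summing over [maps] would put [w ^ a1 * tot] below
   [N ^ k.+2 + w ^ (a1 + c') * edg], hence below twice [N ^ k.+2], against [htot]. *)
have [F hF1 hF2] : exists2 F, N ^ 2 <= w ^ a1 * (#|roots F| * #|away F|) &
    w ^ c' * \sum_(v in roots F) #|nb e v (away F)| <= #|roots F| * #|away F|.
  apply: contrapT => hno.
  have hlt F : w ^ a1 * (#|roots F| * #|away F|) <
      N ^ 2 + w ^ (a1 + c') * \sum_(v in roots F) #|nb e v (away F)|.
    have [h1|h1] := leqP (N ^ 2) (w ^ a1 * (#|roots F| * #|away F|)); last first.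
      by apply: leq_trans h1 (leq_addr _ _).
    apply: (@leq_trans (w ^ (a1 + c') * \sum_(v in roots F) #|nb e v (away F)|));
      last exact: leq_addl.
    rewrite expnD -mulnA ltn_pmul2l // ltnNge; apply/negP => h2.
    by apply: hno; exists F.
  have mapsp : 0 < #|maps| by rewrite card_maps expn_gt0 -/N N0.
  have : w ^ a1 * tot < N ^ k.+2 + w ^ (a1 + c') * edg.
    have -> : N ^ k.+2 = \sum_(f in maps) N ^ 2.
      by rewrite sum_nat_const card_maps -/N -expnD addn2.
    rewrite /tot /edg !big_distrr -big_split /=.
    apply: (@leq_trans (\sum_(f in maps) (w ^ a1 * (#|roots f| * #|away f|)).+1)).
      under [X in _ <= X]eq_bigr => f _ do rewrite -addn1.
      by rewrite big_split /= sum1_card -addn1 leq_add2l.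
    by apply: leq_sum => f _; exact: hlt.
  have : 2 * (w ^ (5 * k + q + 1) * tot) <= w ^ a1 * tot.
    have -> : a1 = (5 * k + q + 1).+1 by rewrite /a1; lia.
    by rewrite mulnA leq_mul2r wS orbT.
  by lia.
set P := roots F in hF1 hF2; set X := away F in hF1 hF2.
have PS : P \subset S.
  by apply/subsetP => v; rewrite inE => /embP[/(_ p)]; rewrite ffunE eqxx.
have XS : X \subset S by apply/subsetP => v; rewrite inE => /andP[].
have cP := subset_leq_card PS; have cX := subset_leq_card XS; rewrite -/N in cP cX.
rewrite -mulnn in hF1.
have hP : N <= w ^ a1 * #|P|.
  by rewrite -(leq_pmul2r N0) (leq_trans hF1) // -mulnA leq_mul2l leq_mul2l cX !orbT.
have hX : N <= w ^ a1 * #|X|.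
  by rewrite -(leq_pmul2r N0) (leq_trans hF1) // -mulnA leq_mul2l mulnC leq_mul2l cP !orbT.
have hN2 : 2 * w ^ a1 <= N.
  by apply: leq_trans (wS a1) _; rewrite /a1 -addn1 -addnA.
have P2 : 1 < #|P| by rewrite -(ltn_pmul2l (wX a1)); lia.
have X2 : 1 < #|X| by rewrite -(ltn_pmul2l (wX a1)); lia.
(* P and X may overlap. Only half of the smaller size is taken from P, so that deleting it from X
   leaves at least half of X. *)
pose t := (minn #|P| #|X|)./2.
have t1 : 0 < t /\ (4 * t >= minn #|P| #|X|) /\ 2 * t <= minn #|P| #|X| by rewrite /t; lia.
have [P1 P1P cP1] : exists2 P1 : {set V}, P1 \subset P & #|P1| = t.
  have /card_geqP[s [us ss sP]] : t <= #|P| by lia.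
  exists [set x in s]; first by apply/subsetP => x; rewrite inE => /sP.
  by rewrite cardsE (card_uniqP us).
pose X1 := X :\: P1.
have X1X : X1 \subset X by apply: subsetDl.
have cX1 : #|X| <= 2 * #|X1|.
  have := cardsID P1 X; rewrite -/X1.
  by have := subset_leq_card (subsetIr X P1); rewrite cP1; lia.
have hP1 : N <= w ^ (a1 + 2) * #|P1|.
  have w4' : 4 <= w ^ 2 by rewrite (@leq_exp2r 2 w 2).
  rewrite expnD -mulnA cP1 (leq_trans _ (_ : w ^ a1 * (4 * t) <= _)) //.
    apply: (@leq_trans (w ^ a1 * minn #|P| #|X|)); first by rewrite /minn; case: ifP.
    by rewrite leq_mul2l; case: t1 => _ [-> _]; rewrite orbT.
  by rewrite leq_mul2l leq_mul2r w4' !orbT.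
have hX1 : N <= w ^ (a1 + 1) * #|X1|.
  rewrite expnD expn1 -mulnA (leq_trans hX) // leq_mul2l; apply/orP; right.
  by rewrite (leq_trans cX1) // leq_mul2r w1 orbT.
set e1 := \sum_(v in P1) #|nb e v X1|.
have he1 : w ^ c' * e1 <= w ^ (2 * a1 + 3) * (#|P1| * #|X1|).
  have : e1 <= \sum_(v in P) #|nb e v X|.
    apply: (@leq_trans (\sum_(v in P1) #|nb e v X|)).
      by apply: leq_sum => v _; apply/subset_leq_card/nbS.
    by rewrite [X in _ <= X](big_setID P1) /= (setIidPr P1P) leq_addr.
  move=> he; apply: (@leq_trans (#|P| * #|X|)).
    by apply: leq_trans hF2; rewrite leq_mul2l he orbT.
  apply: (@leq_trans (N * N)); first exact: leq_mul.
  rewrite (_ : 2 * a1 + 3 = (a1 + 2) + (a1 + 1)); last by lia.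
  by rewrite expnD mulnACA; apply: leq_mul.
(* Vertices of degree at most twice the average are kept on one side, then, with degrees counted
   into P', on the other. By Markov's inequality half of each side survives. *)
pose P' := [set v in P1 | #|P1| * #|nb e v X1| <= 2 * e1].
have cP' : #|P1| <= 2 * #|P'| by exact: (markov P1 (fun v => #|nb e v X1|)).
pose X' := [set x in X1 | #|X1| * #|nb e x P'| <= 2 * \sum_(u in X1) #|nb e u P'|].
have cX' : #|X1| <= 2 * #|X'| by exact: (markov X1 (fun v => #|nb e v P'|)).
have P'P1 : P' \subset P1 by apply/subsetP => v; rewrite inE => /andP[].
have X'X1 : X' \subset X1 by apply/subsetP => v; rewrite inE => /andP[].
have e2 : \sum_(u in X1) #|nb e u P'| <= e1.
  by rewrite (double_count e_sym) /e1 [X in _ <= X](big_setID P') /= (setIidPr P'P1) leq_addr.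
have P1p : 0 < #|P1| by lia.
have X1p : 0 < #|X1| by lia.
have fin_bound y Y Z u : 0 < Z -> Y <= 2 * u -> Z * y <= 2 * e1 -> 
    w ^ c' * e1 <= w ^ (2 * a1 + 3) * (Z * Y) -> w ^ c * y <= u.
  move=> Z0 hY hy hz; rewrite -(leq_pmul2l (wX (2 * a1 + 5))) mulnA -expnD.
  rewrite (_ : 2 * a1 + 5 + c = c'); last by rewrite /c'; lia.
  rewrite -(leq_pmul2l Z0) mulnCA (leq_trans (_ : _ <= w ^ c' * (2 * e1))) //.
    by rewrite leq_mul2l hy orbT.
  rewrite mulnCA (leq_trans (_ : _ <= 2 * (w ^ (2 * a1 + 3) * (Z * Y)))) //.
    by rewrite leq_mul2l hz orbT.
  rewrite (_ : 2 * a1 + 5 = (2 * a1 + 3).+2); last by lia.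
  have h1 := wS (2 * a1 + 3); have h2 := wS (2 * a1 + 3).+1.
  have hm := leq_trans (leq_mul (leqnn 2) h1) h2.
  apply: (@leq_trans (Z * (2 * (2 * w ^ (2 * a1 + 3)) * u))); last first.
    by rewrite leq_mul2l leq_mul2r hm !orbT.
  rewrite (_ : 2 * (_ * (Z * Y)) = Z * (2 * w ^ (2 * a1 + 3) * Y)); last by lia.
  rewrite (_ : 2 * (2 * _) * u = 2 * w ^ (2 * a1 + 3) * (2 * u)); last by lia.
  by rewrite !leq_mul2l hY !orbT.
exists P', X'; split.
- exact: subset_trans P'P1 (subset_trans P1P PS).
- exact: subset_trans X'X1 (subset_trans X1X XS).
- apply: (disjointWl P'P1); apply: (disjointWr X'X1).
  by rewrite -setI_eq0; apply/eqP/setP => x; rewrite !inE; case: (x \in P1).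
- have -> : 5 * k + q + 5 = a1 + 2 + 1 by rewrite /a1; lia.
  split.
    rewrite expnD expn1 -mulnA (leq_trans hP1) // leq_mul2l (leq_trans cP') ?orbT //.
    by rewrite leq_mul2r w1 orbT.
  rewrite (_ : a1 + 2 + 1 = a1 + 1 + 1 + 1); last by lia.
  rewrite expnD expn1 -mulnA (leq_trans hX1) //.
  rewrite (leq_trans (_ : _ <= w ^ (a1 + 1) * (w * #|X'|))) //.
    by rewrite leq_mul2l (leq_trans cX') ?orbT // leq_mul2r w1 orbT.
  by rewrite leq_mul2r leq_exp2l // leq_addr orbT.
- split=> [v vP|x xX].
    apply: (fin_bound _ #|X1| #|P1|) => //.
    apply: (@leq_trans (#|P1| * #|nb e v X1|)); last by move: vP; rewrite inE => /andP[].
    by rewrite leq_mul2l; apply/orP; right; apply/subset_leq_card/nbS.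
  apply: (fin_bound _ #|P1| #|X1|) => //; last by rewrite [_ * #|P1|]mulnC.
  move: xX; rewrite inE => /andP[_ hh]; apply: leq_trans hh _.
  by rewrite leq_mul2l e2 orbT.
Qed.

End Count.

End SparseSplit.

(** * Ultrafilters on nat *)

Record ultra (U : (nat -> Prop) -> Prop) : Prop := Ultra {
  ultra_mono : forall P Q : nat -> Prop, (forall d, P d -> Q d) -> U P -> U Q;
  ultra_and : forall P Q, U P -> U Q -> U (fun d => P d /\ Q d);
  ultra_ex : forall P, U P -> exists d, P d;
  ultra_not : forall P, ~ U P -> U (fun d => ~ P d);
  ultra_cofin : forall k, U (fun d => k <= d)
}.

Lemma ultra_exists : exists U, ultra U.
Proof.
have [G [Gu GF]] := filter.ultraFilterLemma filter.eventually_filter.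
have [[G0 Gf] _] := Gu.
have Gmono (P Q : nat -> Prop) : (forall d, P d -> Q d) -> G P -> G Q.
  by move=> h; apply: filter.filterS.
exists G; split=> //.
- by move=> P Q; apply: filter.filterI.
- move=> P hP; apply: contrapT => hno; apply: G0.
  by apply: Gmono hP => d hd; apply: hno; exists d.
- by move=> P hP; have [] := filter.in_ultra_setVsetC P Gu.
- by move=> k; apply: GF; exists k.
Qed.

Lemma dchoice (I : Type) (T : I -> Type) (P : forall i, T i -> Prop) :
  (forall i, exists x, P i x) -> exists f, forall i, P i (f i).
Proof. by move=> h; exists (fun i => sval (cid (h i))) => i; exact: svalP. Qed.

Section UltraTheory.
Variables (U : (nat -> Prop) -> Prop) (hU : ultra U).

Lemma ultraT (P : nat -> Prop) : (forall d, P d) -> U P.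
Proof. by move=> h; apply: ultra_mono (ultra_cofin hU 0) => // d _; exact: h. Qed.

Lemma ultra1 (P Q : nat -> Prop) : U P -> (forall d, P d -> Q d) -> U Q.
Proof. by move=> h1 h2; exact: ultra_mono h1. Qed.

Lemma ultra2 (P Q R : nat -> Prop) : U P -> U Q -> (forall d, P d -> Q d -> R d) -> U R.
Proof. by move=> h1 h2 h; apply: ultra1 (ultra_and hU h1 h2) _ => d []; exact: h. Qed.

Lemma ultra3 (P Q R S : nat -> Prop) : U P -> U Q -> U R ->
  (forall d, P d -> Q d -> R d -> S d) -> U S.
Proof.
by move=> h1 h2 h3 h; apply: ultra2 (ultra_and hU h1 h2) h3 _ => d []; exact: h.
Qed.

Lemma ultra_false (P : nat -> Prop) : U P -> U (fun d => ~ P d) -> False.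
Proof. by move=> h1 h2; have [d []] := ultra_ex hU (ultra_and hU h1 h2). Qed.

Lemma ultra_all (I : eqType) (l : seq I) (P : I -> nat -> Prop) :
  (forall i, i \in l -> U (P i)) -> U (fun d => forall i, i \in l -> P i d).
Proof.
elim: l => [|x l IH] h; first exact: ultraT.
apply: ultra2 (h x (mem_head _ _)) (IH _) _.
  by move=> i il; apply: h; rewrite inE il orbT.
by move=> d h1 h2 i; rewrite inE => /orP[/eqP->|/h2].
Qed.

Lemma ultra_exS (I : eqType) (l : seq I) (P : I -> nat -> Prop) :
  U (fun d => exists2 i, i \in l & P i d) -> exists2 i, i \in l & U (P i).
Proof.
move=> h; apply: contrapT => hno; apply: ultra_false h _.
apply: ultra1 (@ultra_all _ l (fun i d => ~ P i d) _) _.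
  by move=> i il; apply: ultra_not => // hi; apply: hno; exists i.
by move=> d hd [i il]; apply: hd.
Qed.

Lemma ultra_or (P Q : nat -> Prop) : U (fun d => P d \/ Q d) -> U P \/ U Q.
Proof.
move=> h; have [|b _ hb] := @ultra_exS _ [:: true; false] (fun b d => if b then P d else Q d).
  by apply: ultra1 h _ => d [p|q]; [exists true|exists false].
by case: b hb; [left|right].
Qed.

Lemma ultra_choice (T : nat -> Type) (x0 : forall d, T d) (P : forall d, T d -> Prop) :
  U (fun d => exists x, P d x) -> exists f, U (fun d => P d (f d)).
Proof.
move=> h; have /dchoice [f hf] : forall d, exists x : T d, (exists y, P d y) -> P d x.
  move=> d; have [[x hx]|hn] := pselect (exists y, P d y); first by exists x.
  by exists (x0 d).
by exists f; apply: ultra1 h _ => d; exact: hf.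
Qed.

(* Countable saturation: at [d] we satisfy the largest possible number, up to [d],
   of the increasingly strong conditions. *)
Lemma ultra_sat (T : nat -> Type) (x0 : forall d, T d) (P : nat -> forall d, T d -> Prop) :
  (forall c d x, P c.+1 d x -> P c d x) -> (forall c, U (fun d => exists x, P c d x)) ->
  exists f, forall c, U (fun d => P c d (f d)).
Proof.
move=> mono h.
have mono' c c' d x : c <= c' -> P c' d x -> P c d x.
  by move=> /subnK <-; elim: (c' - c) => // k IH; rewrite addSn => /mono.
have /dchoice [f hf] : forall d, exists x : T d, forall c, c <= d -> (exists y, P c d y) -> P c d x.
  move=> d; suff main k : k <= d.+1 -> exists x : T d, forall c, c < k -> (exists y, P c d y) -> P c d x.
    by have [x hx] := main d.+1 (leqnn _); exists x.
  elim: k => [|k IH] hk; first by exists (x0 d).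
  have [[x hx]|hn] := pselect (exists y, P k d y).
    by exists x => c ck _; apply: mono' hx.
  have [x hx] := IH (ltnW hk); exists x => c; rewrite ltnS leq_eqVlt => /orP[/eqP->//|].
  exact: hx.
exists f => c; apply: ultra2 (h c) (ultra_cofin hU c) _ => d ex cd; exact: hf.
Qed.

End UltraTheory.

(** * Asymptotic counterexamples *)

(* A sequence of graphs behaving, along an ultrafilter, like critical subgraphs of
   counterexamples for larger and larger exponents; a family of sets is large when it has
   size at least the number of vertices over a fixed power of the clique bound [aw]. *)
Record asym := Asym {
  aU : (nat -> Prop) -> Prop;
  aU_ultra : ultra aU;
  aV : nat -> finType;
  ae : forall d, rel (aV d);
  ae_sym : forall d, symmetric (@ae d);
  ae_irr : forall d, irreflexive (@ae d);
  aw : nat -> nat;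
  aw1 : forall d, 1 < aw d;
  a_cardV : forall q, aU (fun d => aw d ^ q <= #|aV d|);
  a_clique : forall d (Q : {set aV d}),
    (forall x y, x \in Q -> y \in Q -> x != y -> ae x y) -> #|Q| <= aw d;
  am : nat;
  am0 : 0 < am;
  apar : nat -> nat;
  apar_lt : forall v, 0 < v < am -> apar v < v;
  a_noemb : forall d (f : nat -> aV d), ~ (forall i j, i < am -> j < am ->
    (i != j -> f i != f j) /\ ae (f i) (f j) = te apar i j);
  a_coh : forall (A B : forall d, {set aV d}) q, (forall d, [disjoint A d & B d]) ->
    aU (fun d => #|aV d| <= aw d ^ q * #|A d|) -> aU (fun d => #|aV d| <= aw d ^ q * #|B d|) ->
    ~ aU (fun d => acomp (@ae d) (A d) (B d))
}.

Section Asym.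
Variable G : asym.
Local Notation U := (aU G).
Local Notation hU := (aU_ultra G).
Local Notation V := (aV G).
Local Notation e := (@ae G _).
Local Notation w := (aw G).
Local Notation m := (am G).
Local Notation par := (apar G).

Definition fam := forall d, {set V d}.
Definition big (A : fam) := exists q, U (fun d => #|V d| <= w d ^ q * #|A d|).
Definition sub (A B : fam) := forall d, A d \subset B d.
Definition disj (A B : fam) := forall d, [disjoint A d & B d].
Definition sparse (A B : fam) := forall q,
  U (fun d => forall v, v \in A d -> w d ^ q * #|nb e v (B d)| <= #|B d|).

Lemma wX_gt0 d q : 0 < w d ^ q.
Proof. by rewrite expn_gt0 ltnW // aw1. Qed.

Lemma leq_wX c d : c <= w d ^ c.
Proof. exact/ltnW/ltn_expl/aw1. Qed.

Lemma big_leX (A B : fam) q : U (fun d => #|A d| <= w d ^ q * #|B d|) -> big A -> big B.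
Proof.
move=> h [q' hA]; exists (q' + q); apply: (ultra2 hU h hA) => d h1 h2.
by rewrite expnD -mulnA (leq_trans h2) // leq_mul2l h1 orbT.
Qed.

Lemma big_leM (A B : fam) c : U (fun d => #|A d| <= c * #|B d|) -> big A -> big B.
Proof.
move=> h; apply: (@big_leX _ _ c); apply: (ultra1 hU h) => d h1.
by rewrite (leq_trans h1) // leq_mul2r leq_wX orbT.
Qed.

Lemma big_ge (A : fam) q : big A -> U (fun d => w d ^ q <= #|A d|).
Proof.
move=> [q' hA]; apply: (ultra2 hU hA (a_cardV G (q' + q))) => d h1 h2.
by rewrite -(leq_pmul2l (wX_gt0 d q')) -expnD (leq_trans h2).
Qed.

Lemma big_gt0 (A : fam) : big A -> U (fun d => 0 < #|A d|).
Proof. by move=> /(big_ge 0). Qed.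

Lemma big_setT : big (fun d => setT).
Proof. by exists 0; apply: ultraT hU _ _ => d; rewrite mul1n cardsT. Qed.

Lemma coh (A B : fam) : big A -> big B -> disj A B ->
  U (fun d => acomp e (A d) (B d)) -> False.
Proof.
move=> [q hA] [q' hB] dAB; apply: (@a_coh G A B (q + q')) => //.
  apply: (ultra1 hU hA) => d h; rewrite (leq_trans h) // leq_mul2r leq_exp2l ?aw1 //.
  by rewrite leq_addr orbT.
apply: (ultra1 hU hB) => d h; rewrite (leq_trans h) // leq_mul2r leq_exp2l ?aw1 //.
by rewrite leq_addl orbT.
Qed.

(** Shrinking B to a big set costs a fixed power of w, which is absorbed because sparsity holds for
    every exponent. *)
Lemma sparse_sub (A A' B B' : fam) : sub A' A -> sub B' B -> big B' -> sparse A B -> sparse A' B'.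
Proof.
move=> sA sB [q' bB'] sAB q; apply: (ultra2 hU bB' (sAB (q' + q))) => d h1 h2 v vA.
have := h2 v (subsetP (sA d) _ vA); rewrite expnD -mulnA => h3.
rewrite -(leq_pmul2l (wX_gt0 d q')); apply: leq_trans (leq_trans h3 (leq_trans (max_card _) h1)).
by rewrite !leq_mul2l; apply/orP; right; apply/orP; right; apply/subset_leq_card/nbS.
Qed.

Definition dense k (S : fam) := exists q, U (fun d => #|S d| ^ k <= w d ^ q * #|emb e par k (S d)|).

Lemma dense1 S : dense 1 S.
Proof.
exists 0; apply: ultraT hU _ _ => d; rewrite mul1n expn1.
rewrite -(@card_imset _ _ (fun v : V d => [ffun _ : 'I_1 => v])); last first.
  by move=> u v /(congr1 (fun f : {ffun 'I_1 -> V d} => f ord0)); rewrite !ffunE.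
apply: subset_leq_card; apply/subsetP => f /imsetP[v vS ->]; apply/embP.
split=> [i|i j]; rewrite !ffunE // !ord1 eqxx ae_irr; split=> //.
Qed.

Lemma not_dense_m S : big S -> ~ dense m S.
Proof.
move=> bS [q hq]; apply: (ultra_false hU hq); apply: (ultra1 hU (big_gt0 bS)) => d S0.
rewrite (_ : emb e par m (S d) = set0) ?cards0 ?muln0.
  by apply/negP; rewrite -ltnNge expn_gt0 S0.
apply/setP => f; rewrite in_set0; apply/negbTE/negP => /embP[h1 h2].
apply: (@a_noemb G d (fun i => f (insubd (Ordinal (am0 G)) i))) => i j im jm.
have vi k : k < m -> nat_of_ord (insubd (Ordinal (am0 G)) k) = k by move=> km; rewrite insubdK.
have [h3 h4] := h2 (insubd (Ordinal (am0 G)) i) (insubd (Ordinal (am0 G)) j).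
rewrite h4 !vi //; split=> // ij; apply: h3; apply: contraNneq ij.
by move=> /(congr1 (@nat_of_ord _)); rewrite !vi // => ->.
Qed.

(** Density always holds for one vertex, and fails on big sets for the whole tree, of which there is
    no copy. Hence its inheritance by all big subsets breaks down at some k in between. *)
Lemma dense_threshold (S : fam) : big S -> exists k S', [/\ 0 < k < m, sub S' S, big S',
  forall S'', sub S'' S' -> big S'' -> dense k S'' & ~ dense k.+1 S'].
Proof.
move=> bS; apply: contrapT => hno.
suff hd k : 0 < k <= m -> forall S'', sub S'' S -> big S'' -> dense k S''.
  have hS : sub S S by move=> d; exact: subxx.
  by apply: (not_dense_m bS); apply: hd; rewrite ?am0 ?leqnn.
elim: k => [//|[|k] IH] hk S'' sS bS''; first exact: dense1.
apply: contrapT => hn; apply: hno; exists k.+1, S''; split=> //.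
move=> S3 s3 b3; apply: IH => //; first by case/andP: hk => _ /ltnW.
by move=> d; exact: subset_trans (s3 d) (sS d).
Qed.

Lemma sparse_pair (S : fam) : big S -> exists A B : fam,
  [/\ sub A S, sub B S, disj A B, big A /\ big B & sparse A B /\ sparse B A].
Proof.
move=> /dense_threshold [k [S' [hk sS' bS' hd hnd]]].
(* Density gives an exponent for each family separately. A common one exists, since otherwise
   saturation would combine the failures for all exponents into one big family that is not dense. *)
have [q hq] : exists q, U (fun d => forall S'' : {set V d}, S'' \subset S' d ->
    #|S' d| <= 16 * w d * #|S''| -> #|S''| ^ k <= w d ^ q * #|emb e par k S''|).
  apply: contrapT => hno.
  pose P c d (X : {set V d}) := [/\ X \subset S' d, #|S' d| <= 16 * w d * #|X|
    & w d ^ c * #|emb e par k X| < #|X| ^ k].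
  have [|c|F hF] := @ultra_sat U hU (fun d => {set V d}) (fun=> set0) P.
  - move=> c d X [h1 h2 h3]; split=> //; apply: leq_ltn_trans h3.
    by rewrite leq_mul2r leq_exp2l ?leqnSn ?orbT // aw1.
  - apply: (ultra1 hU (ultra_not hU (fun hc => hno (ex_intro _ c hc)))) => d hn.
    apply: contrapT => hn2; apply: hn => X XS hX; rewrite leqNgt; apply/negP => hlt.
    by apply: hn2; exists X.
  pose F' d := F d :&: S' d.
  have FE c : U (fun d => F' d = F d /\ P c d (F d)).
    by apply: (ultra1 hU (hF c)) => d hP; split=> //; case: hP => /setIidPl.
  have bF : big F'.
    apply: (@big_leX S' _ 5) bS'; apply: (ultra1 hU (FE 0)) => d [-> [_ h2 _]].
    rewrite (leq_trans h2) // leq_mul2r expnSr leq_mul2r.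
    by rewrite (@leq_trans (2 ^ 4)) ?leq_exp2r ?aw1 ?orbT.
  have sF : sub F' S' by move=> d; exact: subsetIr.
  have [c hc] := hd F' sF bF; apply: (ultra_false hU hc).
  apply: (ultra1 hU (FE c)) => d [-> [_ _ h3]]; apply/negP; rewrite -ltnNge.
  exact: h3.
have hs b : U (fun d => w d ^ b * #|emb e par k.+1 (S' d)| <= #|S' d| ^ k.+1).
  have := ultra_not hU (fun h => hnd (ex_intro _ b h)).
  by move=> h; apply: (ultra1 hU h) => d /negP; rewrite -ltnNge => /ltnW.
(* The size loss a is independent of the sparsity exponent c, so saturation over c yields one big
   pair that is sparse for all exponents. *)
pose a := 5 * k + q + 5.
pose P c d (AB : {set V d} * {set V d}) := [/\ AB.1 \subset S' d, AB.2 \subset S' d,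
  [disjoint AB.1 & AB.2], #|S' d| <= w d ^ a * #|AB.1| /\ #|S' d| <= w d ^ a * #|AB.2|
    & (forall v, v \in AB.1 -> w d ^ c * #|nb e v AB.2| <= #|AB.2|) /\
      (forall v, v \in AB.2 -> w d ^ c * #|nb e v AB.1| <= #|AB.1|)].
have [|c|F hF] := @ultra_sat U hU (fun d => ({set V d} * {set V d})%type) (fun=> (set0, set0)) P.
- move=> c d X [h1 h2 h3 h4 [h5 h6]]; split=> //; split=> v vX.
    by apply: leq_trans (h5 v vX); rewrite leq_mul2r leq_exp2l ?leqnSn ?orbT // aw1.
  by apply: leq_trans (h6 v vX); rewrite leq_mul2r leq_exp2l ?leqnSn ?orbT // aw1.
- apply: (ultra3 hU hq (big_ge (5 * k + q + 3) bS') (hs (3 * (5 * k + q + 2) + c + 5))).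
  move=> d h1 h2 h3.
  have kp : par k < k by apply: apar_lt.
  have kl i : 0 < i < k -> par i < i by move=> hi; apply: apar_lt; lia.
  have [A [B hAB]] := @sparse_split (V d) e (@ae_sym G d) (@ae_irr G d) par k (Ordinal kp) (S' d)
     erefl kl (w d) q c (aw1 G d) (@a_clique G d) h1 h2 h3.
  by exists (A, B).
(* [F d] behaves well only along the ultrafilter; the intersections and the difference enforce
   inclusion and disjointness for every d. *)
pose A d := (F d).1 :&: S' d; pose B d := ((F d).2 :&: S' d) :\: A d.
have FE c : U (fun d => [/\ A d = (F d).1, B d = (F d).2 & P c d (F d)]).
  apply: (ultra1 hU (hF c)) => d hP; have [/setIidPl h1 /setIidPl h2 h3 _ _] := hP.
  split=> //; rewrite /B /A h1 h2; apply/setDidPl; by rewrite disjoint_sym.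
have trS X : sub X S' -> sub X S by move=> h d; exact: subset_trans (h d) (sS' d).
exists A, B; split.
- by apply: trS => d; exact: subsetIr.
- by apply: trS => d; apply: subset_trans (subsetDl _ _) (subsetIr _ _).
- by move=> d; rewrite -setI_eq0; apply/eqP/setP => x; rewrite !inE;
  case: (x \in (F d).1); case: (x \in S' d); rewrite ?andbF.
- split; apply: (@big_leX S' _ a) bS'; apply: (ultra1 hU (FE 0)) => d [hA hB [_ _ _ [h1 h2] _]].
    by rewrite hA.
  by rewrite hB.
- split=> c; apply: (ultra1 hU (FE c)) => d [-> -> [_ _ _ _ [h1 h2]]] v.
    exact: h1.
  exact: h2.
Qed.

Definition blk (B : nat -> fam) (s : seq nat) :=
  (forall i, i \in s -> big (B i)) /\
  (forall i j, i \in s -> j \in s -> i != j -> disj (B i) (B j) /\ sparse (B i) (B j)).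

Lemma sparse_blockade K (S : fam) : big S ->
  exists B, blk B (iota 0 K) /\ forall i, i < K -> sub (B i) S.
Proof.
elim: K S => [|K IH] S bS; first by exists (fun=> S).
have [A [S' [sA sS' dAS [bA bS'] [spA spS]]]] := sparse_pair bS.
have [B [[h1 h2] h3]] := IH S' bS'.
pose B' i := if i is j.+1 then B j else A.
exists B'; split; last first.
  by case=> [|i] //= hi d; apply: subset_trans (h3 i hi d) (sS' d).
have mi i : i \in iota 0 K = (i < K) by rewrite mem_iota.
split.
  by case=> [|i]; rewrite mem_iota //= add0n ltnS => hi; apply: h1; rewrite mi.
case=> [|i] [|j]; rewrite !mem_iota //= !add0n !ltnS => hi hj ij.
- split; last by apply: (sparse_sub _ (h3 j hj) _ spA) => //; apply: h1; rewrite mi.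
  by move=> d; apply: disjointWr (h3 j hj d) (dAS d).
- split; last by apply: (sparse_sub (h3 i hi) _ _ spS).
  by move=> d; rewrite disjoint_sym; apply: disjointWr (h3 i hi d) (dAS d).
- by apply: h2; rewrite ?mi.
Qed.

End Asym.

(** * Shrinking blockades *)

Definition subseqs (s : seq nat) := [seq mask (val b) s | b <- enum {: (size s).-tuple bool}].

Lemma mem_subseqs s S : (S \in subseqs s) = subseq S s.
Proof.
apply/mapP/subseqP => [[b _ ->]|[b sb ->]].
  by exists (val b) => //; rewrite size_tuple.
by exists (tcast sb (in_tuple b)); rewrite ?mem_enum //= val_tcast.
Qed.

Section Shrink.
Variable G : asym.
Local Notation U := (aU G).
Local Notation hU := (aU_ultra G).
Local Notation V := (aV G).
Local Notation e := (@ae G _).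
Local Notation m := (am G).
Local Notation par := (apar G).
Implicit Types (B C : nat -> fam G) (s S Y : seq nat).

Definition shr B' B s := forall i, i \in s -> sub (B' i) (B i) /\ big (B' i).
Definition patch s C B : nat -> fam G := fun i => if i \in s then C i else B i.

Lemma shr_refl B s : blk B s -> shr B B s.
Proof. by case=> h _ i /h; split=> // d; exact: subxx. Qed.

Lemma shr_trans B'' B' B s : shr B'' B' s -> shr B' B s -> shr B'' B s.
Proof.
move=> h1 h2 i si; have [a1 b1] := h1 i si; have [a2 b2] := h2 i si.
by split=> // d; exact: subset_trans (a1 d) (a2 d).
Qed.

Lemma shr_mem B' B s s' : {subset s' <= s} -> shr B' B s -> shr B' B s'.
Proof. by move=> h1 h2 i /h1; exact: h2. Qed.

Lemma blk_mem B s s' : {subset s' <= s} -> blk B s -> blk B s'.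
Proof. by move=> h [h1 h2]; split=> [i /h /h1//|i j /h hi /h hj]; exact: h2. Qed.

Lemma blk_shr B' B s : shr B' B s -> blk B s -> blk B' s.
Proof.
move=> h [h1 h2]; split=> [i /h []//|i j si sj ij].
have [d1 s1] := h2 i j si sj ij; have [a1 b1] := h i si; have [a2 b2] := h j sj.
split; last exact: sparse_sub s1.
by move=> d; apply: disjointWl (a1 d) _; apply: disjointWr (a2 d) (d1 d).
Qed.

Lemma shr_patch C B s S : blk B s -> {subset S <= s} -> shr C B S -> shr (patch S C B) B s.
Proof.
move=> hb hS hC i si; rewrite /patch; case: ifP => iS; first exact: hC.
exact: shr_refl hb i si.
Qed.

(** The properties are handled one at a time. If some shrinking makes P x fail, pass to it, and
    monotonicity keeps P x false afterwards; otherwise P x already survives every shrinking. *)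
Lemma decide (I : eqType) (l : seq I) (P : I -> (nat -> fam G) -> Prop) B s : blk B s ->
  (forall i B' B'', i \in l -> shr B'' B' s -> P i B'' -> P i B') ->
  exists B', shr B' B s /\
    forall i, i \in l -> ~ P i B' \/ forall B'', shr B'' B' s -> P i B''.
Proof.
elim: l B => [|x l IH] B hB mono; first by exists B; split=> //; exact: shr_refl.
have [B1 [s1 h1]] : exists B1, shr B1 B s /\
    (~ P x B1 \/ forall B'', shr B'' B1 s -> P x B'').
  have [[B1 [s1 n1]]|hn] := pselect (exists B1, shr B1 B s /\ ~ P x B1).
    by exists B1; split=> //; left.
  exists B; split; [exact: shr_refl | right=> B'' sB''].
  by apply: contrapT => hP; apply: hn; exists B''.
have [|B2 [s2 h2]] := IH B1 (blk_shr s1 hB).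
  by move=> i B' B'' il; apply: mono; rewrite inE il orbT.
exists B2; split; first exact: shr_trans s1.
move=> i; rewrite inE => /orP[/eqP->|/h2//].
case: h1 => h1; [left|right] => [hP|B'' sB].
  by apply: h1; apply: mono s2 hP; exact: mem_head.
by apply: h1; exact: shr_trans s2.
Qed.

(** Whatever vertices are later chosen in the blocks [C j], block i then offers a vertex adjacent to
    the one chosen in [C l] and to none of the others. *)
Definition coverable B i Y l := exists C, shr C B Y /\
  U (fun d => exists R : {set V d}, [/\ R \subset B i d,
    forall c, c \in C l d -> exists2 r, r \in R & e r c
    & forall j, j \in Y -> j != l -> acomp e R (C j d)]).

Lemma coverable_mono B B' i Y l : shr B' B (i :: Y) -> coverable B' i Y l -> coverable B i Y l.
Proof.
move=> h [C [hC hR]]; exists C; split.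
  by apply: shr_trans hC (shr_mem _ h) => j jY; rewrite inE jY orbT.
apply: (ultra1 hU hR) => d [R [h1 h2 h3]]; exists R; split=> //.
by apply: subset_trans h1 _; case: (h i (mem_head _ _)).
Qed.

(** The blocks x 0, x 1, ... are to host the tree vertices m - 1, m - 2, ..., 0. Successively each
    block is made to cover the block of the parent of its tree vertex and to miss the other later
    ones; afterwards the tree is chosen from its root upwards. *)
Lemma free_embed B s : uniq s -> size s = 2 * m -> blk B s ->
  (forall S l B', subseq S s -> size S = m.+1 -> l < m -> shr B' B s ->
     coverable B' (head 0 S) (behead S) (nth 0 (behead S) l)) -> False.
Proof.
move=> us ss hB hP; have m0 := am0 G.
pose x i := nth 0 s i.
have xs i : i < 2 * m -> x i \in s by move=> hi; apply: mem_nth; rewrite ss.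
have xinj i j : i < 2 * m -> j < 2 * m -> (x i == x j) = (i == j).
  by move=> hi hj; apply: nth_uniq; rewrite ?ss.
(* However the vertices below m - k are chosen in their blocks, the remaining ones can be added with
   correct adjacency for every pair involving an added vertex. *)
pose inv k B' := U (fun d => forall f : nat -> V d,
  (forall v, v < m - k -> f v \in B' (x (m.-1 - v)) d) ->
  exists g : nat -> V d, (forall v, v < m - k -> g v = f v) /\
   forall i j, i < m -> j < m -> i != j -> m - k <= maxn i j ->
     g i != g j /\ e (g i) (g j) = te par i j).
have main k : k < m -> exists B', shr B' B s /\ inv k B'.
  elim: k => [|k IH] km.
    exists B; split; first exact: shr_refl.
    by apply: ultraT hU _ _ => d f _; exists f; split=> // i j im jm _; lia.
  have [B1 [s1 inv1]] := IH (ltnW km).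
  pose v0 := m.-1 - k; pose u := par v0.
  have v00 : 0 < v0 by rewrite /v0; lia.
  have v0m : v0 < m by rewrite /v0; lia.
  have uv : u < v0 by apply: apar_lt; rewrite v00.
  (* Block x k followed by the next m blocks, among which are those of all smaller tree vertices.
     The length 2m leaves room for every k < m. *)
  pose S := take m.+1 (drop k s).
  have Ss : subseq S s by apply: subseq_trans (take_subseq _ _) (drop_subseq _ _).
  have szS : size S = m.+1 by rewrite size_takel // size_drop ss; lia.
  have nS i : i < m.+1 -> nth 0 S i = x (k + i) by move=> hi; rewrite nth_take // nth_drop.
  have hS : head 0 S = x k by rewrite -nth0 nS // addn0.
  have bS i : i < m -> nth 0 (behead S) i = x (k.+1 + i).
    by move=> hi; rewrite nth_behead nS // addnS.
  have inY v : v < v0 -> x (m.-1 - v) \in behead S.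
    move=> vv; have -> : m.-1 - v = k.+1 + (m.-1 - v - k.+1) by rewrite /v0 in vv; lia.
    by rewrite -bS; [apply: mem_nth; rewrite size_behead szS | ]; rewrite /v0 in vv; lia.
  pose l := m.-1 - u - k.+1.
  have hl : l < m by rewrite /l; lia.
  have := hP S l B1 Ss szS hl s1.
  have -> : nth 0 (behead S) l = x (m.-1 - u).
    by rewrite bS //; congr x; rewrite /l; rewrite /v0 in uv; lia.
  rewrite hS => -[C [sC hR]].
  have Ys : {subset behead S <= s} by move=> i /mem_behead; exact: mem_subseq.
  have b1 := blk_shr s1 hB.
  exists (patch (behead S) C B1); split.
    by apply: shr_trans s1; exact: shr_patch.
  apply: (ultra2 hU hR inv1) => d [R [RB Rc Ra]] hinv f hf.
  have fC v : v < v0 -> f v \in C (x (m.-1 - v)) d.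
    by move=> vv; have := hf v; rewrite /patch inY //; apply; rewrite /v0 in vv; lia.
  have [r rR er] := Rc _ (fC u uv).
  pose f' v := if v == v0 then r else f v.
  have fB v : v < v0 -> f v \in B1 (x (m.-1 - v)) d.
    by move=> vv; apply: (subsetP _ _ (fC v vv)); case: (sC _ (inY v vv)).
  have xk : x k = x (m.-1 - v0) by congr x; rewrite /v0; lia.
  have f'B v : v < m - k -> f' v \in B1 (x (m.-1 - v)) d.
    move=> vm; rewrite /f'; case: eqP => [->|/eqP vv]; first by rewrite -xk (subsetP RB).
    by apply: fB; rewrite /v0 in vv *; lia.
  have [g [hg1 hg2]] := hinv f' f'B.
  have key j : j < v0 -> r != f j /\ e r (f j) = te par v0 j.
    move=> jv; split.
      have : disj (B1 (x k)) (B1 (x (m.-1 - j))).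
        have [_ hd] := b1; have [|||//] := hd (x k) (x (m.-1 - j)).
        - by apply: xs; lia.
        - by apply: xs; lia.
        - by rewrite xinj; rewrite /v0 in jv; lia.
      move=> /(_ d) hdis; apply: contraTneq (subsetP RB _ rR) => ->.
      by rewrite (disjointFl hdis (fB j jv)).
    have -> : te par v0 j = (j == u).
      rewrite /te v00 /= -/u (eq_sym u); apply: orb_idl => /andP[j0 /eqP hj].
      have : par j < j by apply: apar_lt; rewrite j0; lia.
      by rewrite hj; lia.
    have [->//|ju] := eqVneq j u.
    apply/negbTE/(Ra (x (m.-1 - j))) => //; [exact: inY | | exact: fC].
    by rewrite xinj; rewrite /v0 in jv uv; lia.
  exists g; split.
    move=> v vm; rewrite hg1; last by lia.
    by rewrite /f'; case: eqP => // hv; rewrite /v0 in hv; lia.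
  move=> i j im jm ij hmax.
  have [h1|h1] := leqP (m - k) (maxn i j); first exact: hg2.
  have gv0 : g v0 = r by rewrite hg1 /f' ?eqxx // /v0; lia.
  have gj j' : j' < v0 -> g j' = f j'.
    move=> jv; rewrite hg1; last by rewrite /v0 in jv; lia.
    by rewrite /f' (ltn_eqF jv).
  have [iv|jv] : (i = v0 /\ j < v0) \/ (j = v0 /\ i < v0) by rewrite /v0; lia.
    by case: iv => -> jv; rewrite gv0 gj //; exact: key.
  case: jv => -> iv; rewrite gv0 gj // eq_sym ae_sym teC; exact: key.
have [B' [sB' inv']] := main m.-1 ltac:(by rewrite prednK).
have hx : x m.-1 \in s by apply: xs; lia.
have bx : big (B' (x m.-1)) by case: (sB' _ hx).
have [d [hd]] := ultra_ex hU (ultra_and hU inv' (big_gt0 bx)).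
rewrite card_gt0 => /set0Pn[y yB].
have [|g [_ hg]] := hd (fun=> y).
  move=> v hv; have -> : v = 0 by lia.
  by rewrite subn0.
apply: (@a_noemb G d g) => i j im jm.
have [->|ij] := eqVneq i j; last by have [] := hg i j im jm ij; lia.
by rewrite ae_irr (te_irr (@apar_lt G)) .
Qed.

Definition killed B s := exists2 l, l < m & forall S, subseq S s -> size S = m.+1 ->
  ~ coverable B (head 0 S) (behead S) (nth 0 (behead S) l).

Lemma head_behead_mem S i : 0 < size S -> i \in head 0 S :: behead S -> i \in S.
Proof. by case: S. Qed.

Lemma killed_mono B B' s s' : subseq s' s -> shr B' B s' -> killed B s -> killed B' s'.
Proof.
move=> ss sh [l lm hl]; exists l => // S Ss szS hp.
apply: (hl S (subseq_trans Ss ss) szS); apply: coverable_mono hp.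
apply: (shr_mem _ sh) => i /head_behead_mem hi; apply: (mem_subseq Ss).
by apply: hi; rewrite szS.
Qed.

(** First [decide] fixes coverability for all subsequences and positions. Each subsequence is
    coloured by the first position that cannot be covered, or by m if there is none. On a uniform
    part colour m contradicts [free_embed], and any other colour is the position wanted. *)
Lemma kill_one M : exists K, forall B s, uniq s -> blk B s -> K <= size s ->
  exists B' s', [/\ shr B' B s, subseq s' s, size s' = M & killed B' s'].
Proof.
have [K hK] := ramsey m.+1 m.+1 (maxn M (2 * m)).
exists K => B s us hB hs.
pose l := [seq (Z, i) | Z <- subseqs s, i <- iota 0 m].
pose P (Si : seq nat * nat) B := size Si.1 = m.+1 /\
  coverable B (head 0 Si.1) (behead Si.1) (nth 0 (behead Si.1) Si.2).
have [|B' [sB' hB']] := @decide _ l P B s hB.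
  move=> [S i] B1 B2 /allpairsP[[S' i'] /= [hS _ [-> _]]] s12 [szS hp]; split=> //.
  apply: coverable_mono hp; apply: (shr_mem _ s12) => j /head_behead_mem hj.
  by rewrite mem_subseqs in hS; apply: (mem_subseq hS); apply: hj; rewrite szS.
pose col S := find (fun i => `[< ~ coverable B' (head 0 S) (behead S) (nth 0 (behead S) i) >]) (iota 0 m).
have colm S : col S < m.+1 by rewrite ltnS -[X in _ <= X](size_iota 0 m) find_size.
have [h [k [km hh szh hcol]]] := hK s col hs colm.
have [kE|klt] := eqVneq k m; last first.
  have {klt km}km : k < m by rewrite ltn_neqAle klt.
  exists B', (take M h); split=> //.
  - by apply: subseq_trans (take_subseq _ _) hh.
  - by rewrite size_takel // szh leq_maxl.
  - exists k => // S Ss szS; have hc := hcol S (subseq_trans Ss (take_subseq _ _)) szS.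
    have : has (fun i => `[< ~ coverable B' (head 0 S) (behead S) (nth 0 (behead S) i) >]) (iota 0 m).
      by rewrite has_find -/(col S) hc size_iota.
    by move=> /(nth_find 0); rewrite -/(col S) hc nth_iota // => /asboolP.
exfalso; have hs' : subseq (take (2 * m) h) s by apply: subseq_trans (take_subseq _ _) hh.
apply: (@free_embed B' (take (2 * m) h)).
- exact: subseq_uniq hs' us.
- by rewrite size_takel // szh leq_maxr.
- by apply: (blk_mem (mem_subseq hs')); exact: blk_shr hB.
move=> S i B2 Ss szS im s2.
have hS : subseq S s := subseq_trans Ss hs'.
have : coverable B' (head 0 S) (behead S) (nth 0 (behead S) i).
  apply: contrapT => hn; have := hcol S (subseq_trans Ss (take_subseq _ _)) szS.
  rewrite kE => hc; have : i \in iota 0 m by rewrite mem_iota.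
  have /hasPn hno : ~~ has (fun i => `[< ~ coverable B' (head 0 S) (behead S) (nth 0 (behead S) i) >]) (iota 0 m).
    by rewrite has_find -/(col S) hc size_iota ltnn.
  by move=> /hno /negP; apply; apply/asboolP.
move=> hp; have [|[]//|rob] := hB' (S, i).
- by apply/allpairsP; exists (S, i); rewrite /= mem_subseqs hS mem_iota.
have [|_] := rob (patch (take (2 * m) h) B2 B').
  apply: shr_patch => //; [exact: blk_shr hB | exact: mem_subseq].
apply: coverable_mono => j /head_behead_mem hj.
have jS : j \in take (2 * m) h by apply: (mem_subseq Ss); apply: hj; rewrite szS.
by rewrite /patch jS; split; [move=> d; exact: subxx | case: (s2 j jS)].
Qed.

(** [kill_one] is applied to the sequence and then to its reversal; what the first application gives
    survives the second, by [killed_mono]. *)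
Lemma killed_blockade M : exists B s,
  [/\ uniq s, size s = M, blk B s, killed B s & killed B (rev s)].
Proof.
have [K1 h1] := kill_one M; have [K2 h2] := kill_one K1.
have [B [hB _]] := sparse_blockade K2 (big_setT G).
have [|B1 [s1 [sh1 ss1 sz1 k1]]] := h2 B _ (iota_uniq 0 K2) hB; first by rewrite size_iota.
have u1 := subseq_uniq ss1 (iota_uniq 0 K2).
have b1 := blk_mem (mem_subseq ss1) (blk_shr sh1 hB).
have [|||B2 [s2 [sh2 ss2 sz2 k2]]] := h1 B1 (rev s1).
- by rewrite rev_uniq.
- by apply: blk_mem b1 => i; rewrite mem_rev.
- by rewrite size_rev sz1.
have ss2' : subseq (rev s2) s1 by rewrite -[s1]revK subseq_rev.
exists B2, (rev s2); rewrite revK; split=> //.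
- exact: subseq_uniq ss2' u1.
- by rewrite size_rev.
- by apply: (blk_mem (mem_subseq ss2')); apply: blk_shr b1 => i hi; apply: sh2; rewrite mem_rev.
- by apply: (killed_mono ss2') k1 => i /(mem_subseq ss2') hi; apply: sh2; rewrite mem_rev.
Qed.

End Shrink.

(** * Covers from comparable degrees *)

Section Core.
Variable G : asym.
Local Notation U := (aU G).
Local Notation hU := (aU_ultra G).
Local Notation V := (aV G).
Local Notation e := (@ae G _).
Implicit Types (B C : nat -> fam G) (s S X Y L R : seq nat).

Lemma mem_bigcup_seq (T : finType) (K : seq nat) (F : nat -> {set T}) x :
  x \in \bigcup_(k <- K) F k -> exists2 k, k \in K & x \in F k.
Proof.
elim: K => [|k K IH]; first by rewrite big_nil inE.
rewrite big_cons inE => /orP[xk|/IH [j jK xj]]; first by exists k; rewrite ?mem_head.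
by exists j => //; rewrite inE jK orbT.
Qed.

Lemma bigcup_seq_sup (T : finType) (K : seq nat) (F : nat -> {set T}) k x :
  k \in K -> x \in F k -> x \in \bigcup_(k <- K) F k.
Proof.
move=> kK xk; elim: K kK => // j K IH; rewrite inE big_cons inE.
by case/orP => [/eqP<-|/IH ->]; rewrite ?xk ?orbT.
Qed.

(** The vertices of large degree in block l and those of bounded degree in the other blocks of Y are
    fed to [greedy_touch]. Keeping only the part of the greedy set in its best block k of L' costs a
    factor [size L'], and the ultrafilter makes k independent of d. Block l shrinks to the touched
    vertices, the others to untouched ones. *)
Lemma comparable_coverable B L' Y (H : fam G) (Q : nat -> nat) Lam l :
  uniq (L' ++ Y) -> blk B (L' ++ Y) -> l \in Y -> 0 < Lam ->
  (forall d, H d \subset \bigcup_(k <- L') B k d) ->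
  U (fun d => 0 < Q d) ->
  U (fun d => #|B l d| <= 8 * #|[set x in B l d | Q d <= 2 * #|nb e x (H d)|]|) ->
  (forall j, j \in Y -> j != l ->
     U (fun d => #|B j d| <= 4 * #|[set x in B j d | #|nb e x (H d)| <= Lam * Q d]|)) ->
  exists2 k, k \in L' & coverable B k Y l.
Proof.
move=> us hB lY Lam0 HL Q0 hT hJ.
have [bb bd] := hB.
have inL k : k \in L' -> k \in L' ++ Y by rewrite mem_cat => ->.
have inY k : k \in Y -> k \in L' ++ Y by rewrite mem_cat orbC => ->.
pose Ls d := [set x in B l d | Q d <= 2 * #|nb e x (H d)|].
pose J j d := [set x in B j d | #|nb e x (H d)| <= Lam * Q d].
have subLs : sub Ls (B l) by move=> d; apply/subsetP => x; rewrite inE => /andP[].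
have bLs : big Ls by apply: (@big_leM G (B l) _ 8 hT); apply: bb; exact: inY.
pose n := size Y; pose c := 32 * (n.+1 * Lam).
have spars : U (fun d => forall k, k \in L' -> forall v, v \in B k d ->
    c * #|nb e v (Ls d)| <= #|Ls d|).
  apply: (ultra_all hU) => k kL.
  have kl : k != l.
    apply: contraTneq us => kl; rewrite cat_uniq; apply/negP => /and3P[_ /hasP h _].
    by apply: h; exists l => //; rewrite -kl.
  have [_ sp] := bd k l (inL _ kL) (inY _ lY) kl.
  have sk : sub (B k) (B k) by move=> d; exact: subxx.
  apply: (ultra1 hU (sparse_sub sk subLs bLs sp c)) => d hd v vk.
  by apply: leq_trans (hd v vk); rewrite leq_mul2r leq_wX orbT.
have hk : U (fun d => exists2 k, k \in L' & exists Rr : {set V d}, [/\ Rr \subset B k d,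
    #|Ls d| <= c * size L' * #|touched e Rr (Ls d)|
    & forall j, j \in Y -> j != l -> 2 * #|touched e Rr (J j d)| <= #|J j d|]).
  apply: (ultra3 hU Q0 spars (big_gt0 bLs)) => d Qd sd Ld.
  pose JJ (i : 'I_n) := if nth 0 Y i == l then set0 else J (nth 0 Y i) d.
  have [||h|Rr [RH R1 R2]] := @greedy_touch (V d) e (@ae_sym G d) n (H d) (Ls d) JJ (Q d) Lam Qd Lam0 Ld.
  - by move=> x; rewrite inE => /andP[].
  - by move=> j x; rewrite /JJ; case: eqP => _; rewrite !inE // => /andP[].
  - by move=> /(subsetP (HL d)) /mem_bigcup_seq[k kL hk]; exact: sd hk.
  have cov : touched e Rr (Ls d) \subset \bigcup_(k <- L') touched e (Rr :&: B k d) (Ls d).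
    apply/subsetP => x; rewrite inE => /andP[xL /existsP[r /andP[rR erx]]].
    have [k kL rk] := mem_bigcup_seq (subsetP (HL d) _ (subsetP RH _ rR)).
    apply: (bigcup_seq_sup kL); rewrite inE xL; apply/existsP; exists r.
    by rewrite inE rR rk.
  have tpos : 0 < #|touched e Rr (Ls d)| by rewrite -/c in R1; case: #|touched _ _ _| R1; lia.
  have [k kL hk] := pigeon_sum tpos (leq_card_bigcup cov).
  exists k => //; exists (Rr :&: B k d); split.
  - exact: subsetIr.
  - rewrite (leq_trans R1) // -/c -mulnA leq_mul2l; apply/orP; right.
    rewrite (leq_trans hk) // leq_mul2l subset_leq_card ?orbT //; exact: subsetIr.
  - move=> j jY jl; have hi : index j Y < n by rewrite index_mem.
    have := R2 (Ordinal hi); rewrite /JJ /= nth_index // (negbTE jl) => hh.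
    apply: leq_trans hh; rewrite leq_mul2l; apply: subset_leq_card.
    apply/subsetP => x; rewrite !inE => /andP[-> /existsP[r]]; rewrite !inE => /andP[/andP[rR _] erx].
    by apply/existsP; exists r; rewrite rR.
have [k kL hk2] := ultra_exS hU hk.
exists k => //; have [Rr hR] := ultra_choice hU (fun d => set0) hk2.
pose C j : fam G := fun d => if j == l then touched e (Rr d) (Ls d)
  else J j d :\: touched e (Rr d) (J j d).
exists C; split; last first.
  apply: (ultra1 hU hR) => d [h1 h2 h3]; exists (Rr d); split=> //.
    move=> x; rewrite /C eqxx inE => /andP[_ /existsP[r /andP[rR erx]]]; by exists r.
  move=> j jY jl r x rR; rewrite /C (negbTE jl) 2!inE => /andP[xt xJ].
  apply/negP => erx; case/negP: xt; rewrite xJ; apply/existsP; exists r; by rewrite rR.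
move=> j jY; have [->|jl] := eqVneq j l.
  split; first by move=> d; rewrite /C eqxx; apply: subset_trans (touched_sub _ _ _) (subLs d).
  apply: (@big_leM G Ls _ (c * size L')) bLs; apply: (ultra1 hU hR) => d [_ h2 _].
  by rewrite /C eqxx.
split.
  move=> d; rewrite /C (negbTE jl); apply: subset_trans (subsetDl _ _) _.
  by apply/subsetP => x; rewrite inE => /andP[].
apply: (@big_leM G (B j) _ 8); last by apply: bb; exact: inY.
apply: (ultra2 hU hR (hJ j jY jl)) => d [_ _ /(_ j jY jl) h3] h4; rewrite /C (negbTE jl).
have := cardsID (touched e (Rr d) (J j d)) (J j d); rewrite (setIidPr (touched_sub _ _ _)).
rewrite -/(J j d) in h4; lia.
Qed.

(** Together the vertices other than p see at most half as many vertices as p does. So at least half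
    of the neighbours of p are good, while at most 3/2 as many vertices are touched. *)
Lemma good_count (T : finType) (r : rel T) (A HH : {set T}) p sz : symmetric r ->
  p \in A -> #|A| <= sz -> 0 < #|nb r p HH| ->
  (forall a, a \in A -> a != p -> (2 * sz).+1 * #|nb r a HH| <= #|nb r p HH|) ->
  0 < #|touched r A HH| /\ #|touched r A HH| <= 3 * #|good r A p HH|.
Proof.
move=> rs pA cA p0 ha.
have sp : nb r p HH \subset touched r A HH.
  by apply/subsetP => x; rewrite !inE => /andP[-> rpx]; apply/existsP; exists p; rewrite pA.
split; first by apply: leq_trans p0 (subset_leq_card sp).
pose O := \bigcup_(a in A :\ p) nb r a HH.
have cO : 2 * #|O| <= #|nb r p HH|.
  have h1 := leq_card_bigcup_in (A :\ p) (fun a => nb r a HH).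
  have h2 : (2 * sz).+1 * \sum_(a in A :\ p) #|nb r a HH| <= sz * #|nb r p HH|.
    apply: (@leq_trans (\sum_(a in A :\ p) #|nb r p HH|)).
      rewrite big_distrr /=; apply: leq_sum => a; rewrite !inE => /andP[ap aA]; exact: ha.
    rewrite sum_nat_const leq_mul2r; apply/orP; right; apply: leq_trans cA.
    exact/subset_leq_card/subsetDl.
  by rewrite -/O in h1; nia.
have t1 : touched r A HH \subset nb r p HH :|: O.
  apply/subsetP => x; rewrite inE => /andP[xH /existsP[a /andP[aA rax]]]; rewrite !inE.
  have [<-|ap] := eqVneq a p; first by rewrite xH rax.
  by apply/orP; right; apply/bigcupP; exists a; rewrite !inE ?ap ?aA // xH.
have t2 : nb r p HH \subset good r A p HH :|: O.
  apply/subsetP => x; rewrite !inE => /andP[xH rpx]; rewrite xH /= /att rs rpx /=.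
  case: (boolP [forall a in A, (a != p) ==> ~~ r x a]) => [//|/forall_inPn[a aA]].
  rewrite negb_imply negbK => /andP[ap rxa].
  by apply/bigcupP; exists a; rewrite !inE ?ap // xH rs.
have := leq_trans (subset_leq_card t1) (leq_card_setU _ _).
have := leq_trans (subset_leq_card t2) (leq_card_setU _ _).
lia.
Qed.

End Core.

(** * Attaching trees at their roots *)

Section Attach.
Variable G : asym.
Local Notation U := (aU G).
Local Notation hU := (aU_ultra G).
Local Notation V := (aV G).
Local Notation e := (@ae G _).
Local Notation m := (am G).
Implicit Types (B C : nat -> fam G) (s S X Y L R : seq nat).

Definition ord (dl : bool) X := if dl then X else rev X.

(* [ord dl X] is read from the root's block on; the block [j0], coming after that of the root
   even when A = [set p], is needed to see that the root has positive degree. *)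
Definition cp dl v sz B X d (A : {set V d}) p :=
  [/\ ofull e m v A p, #|A| <= sz & exists k j0, [/\ subseq [:: k; j0] (ord dl X), p \in B k d
    & forall a, a \in A -> a != p -> exists2 j, subseq [:: k; j] (ord dl X) & a \in B j d]].

Definition unavoidable dl v sz N B s := forall S B', subseq S s -> size S = N -> shr B' B S ->
  U (fun d => exists A p, @cp dl v sz B' S d A p).

(** Block k is the hub. As the trees miss the other shrunk blocks, further trees can be found there
    and attached to the same hub vertices. *)
Definition attach (v : bool -> nat) sz B L X R k dl := k \in L ++ R /\
  exists C, shr C B (L ++ R) /\ U (fun d => forall b, b \in C k d -> exists A p,
    [/\ @cp dl (v dl) sz B X d A p, att e b A p
      & forall j, j \in L ++ R -> j != k -> acomp e A (C j d)]).

Lemma ord_subseq dl X X' : subseq X' X -> subseq (ord dl X') (ord dl X).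
Proof. by case: dl => //=; rewrite subseq_rev. Qed.

Lemma mem_ord dl X i : (i \in ord dl X) = (i \in X).
Proof. by case: dl; rewrite //= mem_rev. Qed.

Lemma subseq2_mem i j X : subseq [:: i; j] X -> i \in X /\ j \in X.
Proof. by move=> /mem_subseq h; split; apply: h; rewrite !inE eqxx ?orbT. Qed.

Lemma subseq2_neq i j X : uniq X -> subseq [:: i; j] X -> i != j.
Proof. by move=> uX /subseq_uniq /(_ uX) /=; rewrite inE andbT. Qed.

Lemma subseq2_total i j X : uniq X -> i \in X -> j \in X -> i != j ->
  subseq [:: i; j] X \/ subseq [:: j; i] X.
Proof.
elim: X => // x X IH /= /andP[xX uX]; rewrite !inE.
have [->|ix] := eqVneq i x; have [->|jx] := eqVneq j x; rewrite ?eqxx //=.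
- by move=> _ jX _; left; rewrite sub1seq.
- by move=> iX _ _; right; rewrite sub1seq.
- exact: IH.
Qed.

Lemma cp_mono dl v v' sz sz' B B' X X' d (A : {set V d}) p : v = v' -> sz' <= sz ->
  subseq X' X -> (forall i, i \in X' -> sub (B' i) (B i)) ->
  cp dl v' sz' B' X' A p -> cp dl v sz B X A p.
Proof.
move=> -> hsz hX hB [h1 h2 [k [j0 [h3 h4 h5]]]]; split=> //; first exact: leq_trans hsz.
have hX' := ord_subseq dl hX.
have hi i j : subseq [:: i; j] (ord dl X') -> sub (B' i) (B i) /\ sub (B' j) (B j).
  by move=> /subseq2_mem; rewrite !mem_ord => -[/hB hi /hB hj].
exists k, j0; split; first exact: subseq_trans hX'.
  by apply: (subsetP _ _ h4); case: (hi _ _ h3).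
move=> a aA ap; have [j hj aj] := h5 a aA ap; exists j; first exact: subseq_trans hX'.
by apply: (subsetP _ _ aj); case: (hi _ _ hj).
Qed.

Lemma unavoidable_mono dl v sz sz' N N' B B' s s' : sz <= sz' -> N <= N' -> subseq s' s -> shr B' B s' ->
  unavoidable dl v sz N B s -> unavoidable dl v sz' N' B' s'.
Proof.
move=> hsz hN ss hB hp S B'' Ss szS sB''.
have tS := subseq_trans (take_subseq S N) Ss.
apply: (ultra1 hU (hp (take N S) B'' (subseq_trans tS ss) _ _)).
- by rewrite size_takel // szS.
- apply: (@shr_trans _ _ B').
    by apply: shr_mem sB''; apply: mem_subseq; exact: take_subseq.
  exact: shr_mem (mem_subseq tS) hB.
move=> d [A [p hc]]; exists A, p; apply: cp_mono hc => //; first exact: take_subseq.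
by move=> i _ d'; exact: subxx.
Qed.

(** The main point is [claim]: any HH keeping half of each block of L and R has a tree in X that
    touches it mostly at vertices attached to its root. Then [process] collects such vertices inside
    a single hub block. *)
Lemma core v sz N : exists n, forall B L X R, uniq (L ++ X ++ R) -> blk B (L ++ X ++ R) ->
  killed B (L ++ X ++ R) -> killed B (rev (L ++ X ++ R)) ->
  (forall dl, unavoidable dl (v dl) sz N B X) -> size X = n -> 0 < size (L ++ R) ->
  exists k dl, attach v sz B L X R k dl.
Proof.
have [n hn] := ramsey 2 3 (maxn N (2 * m)).
exists n => B L X R us hB kl kr hp szX K0.
set K := L ++ R in K0 *.
have [bb bd] := hB.
have uX : uniq X by move: us; rewrite !cat_uniq => /and4P[_ _ -> _].
have inK k : k \in K -> k \in L ++ X ++ R.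
  by rewrite !mem_cat => /orP[->|->]; rewrite ?orbT.
have inX k : k \in X -> k \in L ++ X ++ R by rewrite !mem_cat => ->; rewrite orbT.
have XK k x : k \in K -> x \in X -> x != k.
  move=> kK xX; apply: contraTneq us => xk; move: kK; rewrite -xk mem_cat !cat_uniq => /orP[xL|xR].
    by apply/negP => /and3P[_ /hasP h _]; apply: h; exists x; rewrite ?mem_cat ?xX.
  by apply/negP => /and3P[_ _ /and3P[_ /hasP h _]]; apply: h; exists x.
pose Lam := (2 * sz).+1.
have claim : U (fun d => forall HH : {set V d}, HH \subset \bigcup_(k <- K) B k d ->
   (forall k, k \in K -> #|B k d| <= 2 * #|HH :&: B k d|) ->
   exists dl A p, [/\ cp dl (v dl) sz B X A p, 0 < #|touched e A HH|
     & #|touched e A HH| <= 3 * #|good e A p HH|]).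
  apply: contrapT => /(ultra_not hU) hbad.
  pose bad d (H : {set V d}) := [/\ H \subset \bigcup_(k <- K) B k d,
     forall k, k \in K -> #|B k d| <= 2 * #|H :&: B k d|
     & ~ exists dl A p, [/\ cp dl (v dl) sz B X A p, 0 < #|touched e A H|
     & #|touched e A H| <= 3 * #|good e A p H|]].
  have [HH hHH] : exists HH : fam G, U (fun d => bad d (HH d)).
    apply: (@ultra_choice U hU (fun d => {set V d}) (fun=> set0) bad).
    apply: (ultra1 hU hbad) => d hd; apply: contrapT => hn2; apply: hd => H h1 h2.
    by apply: contrapT => h3; apply: hn2; exists H.
  pose dg d x := #|nb e x (HH d)|.
  have hq i d : exists z : nat * nat, [/\ #|B i d| <= 4 * #|[set x in B i d | @dg d x <= z.1]|,
      #|B i d| <= 4 * #|[set x in B i d | z.2 <= @dg d x]|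
    & #|B i d| <= 2 * #|[set x in B i d | z.1 <= @dg d x <= z.2]|].
    by have [lo [hi hh]] := quantiles (B i d) (@dg d); exists (lo, hi).
  have [F hF] := dchoice (fun i => dchoice (hq i)).
  pose lo i d := (F i d).1; pose hi i d := (F i d).2.
  pose dec i j := U (fun d => Lam * hi j d < lo i d).
  (* Colours 0 and 1 say that the earlier or the later block has degrees into HH larger by the
     factor Lam. Restricting to the middle quantiles, a tree with its root on that side then has a
     dominating root. Colour 2 means comparable degrees. *)
  pose col (x : seq nat) := let i := nth 0 x 0 in let j := nth 0 x 1 in
    if `[< dec i j >] then 0 else if `[< dec j i >] then 1 else 2.
  have colm x : col x < 3 by rewrite /col; do 2 case: ifP => // _.
  have [Z [c [c3 ZX szZ hcol]]] := hn X col (eq_leq (esym szX)) colm.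
  have uZ := subseq_uniq ZX uX.
  have [c2|c2] := eqVneq c 2; last first.
    pose dl := c == 0.
    pose S := take N Z.
    have SZ : subseq S Z := take_subseq _ _.
    have SX := subseq_trans SZ ZX.
    have hdec a b : subseq [:: a; b] (ord dl S) -> dec a b.
      rewrite /dl; case: eqP => [c0|/eqP c0] /= hab.
        have := hcol _ (subseq_trans hab SZ) erefl; rewrite c0 /col /=.
        by case: ifP => [/asboolP//|_]; case: ifP.
      have hba : subseq [:: b; a] S by rewrite -subseq_rev.
      have := hcol _ (subseq_trans hba SZ) erefl; rewrite /col /=.
      case: ifP => [_ c00|_]; first by rewrite -c00 eqxx in c0.
      by case: ifP => [/asboolP//|_ c22]; rewrite -c22 eqxx in c2.
    pose B' i : fam G := fun d => [set x in B i d | lo i d <= @dg d x <= hi i d].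
    have sB' : shr B' B S.
      move=> i iS; split; first by move=> d; apply/subsetP => x; rewrite inE => /andP[].
      apply: (@big_leM G (B i) _ 2); last by apply: bb; apply: inX; exact: (mem_subseq SX).
      by apply: ultraT hU _ _ => d; case: (hF i d).
    have szS : size S = N by rewrite size_takel // szZ leq_maxl.
    have hall : U (fun d => forall a, a \in S -> forall b, b \in S ->
        subseq [:: a; b] (ord dl S) -> Lam * hi b d < lo a d).
      apply: (ultra_all hU) => a aS; apply: (ultra_all hU) => b bS.
      have [hab|hab] := boolP (subseq [:: a; b] (ord dl S)); last exact: (ultraT hU).
      by apply: (ultra1 hU (hdec _ _ hab)).
    have [d [[hd1 hd2] [A [p hc]]]] := ultra_ex hU (ultra_and hU (ultra_and hU hHH hall)
      (hp dl S B' SX szS sB')).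
    case: hd1 => _ _; apply; exists dl, A, p.
    have [hf cA [k [j0 [hk pk ha]]]] := hc.
    have mS a b : subseq [:: a; b] (ord dl S) -> Lam * hi b d < lo a d.
      move=> hab; have [aS bS] := subseq2_mem hab; rewrite !mem_ord in aS bS; exact: hd2.
    have dp : lo k d <= @dg d p by move: pk; rewrite inE => /and3P[].
    have [|||t0 t3] := @good_count (V d) e A (HH d) p sz (@ae_sym G d) _ cA.
    - by apply: full_mem; case: hf => hf _; exact: hf.
    - by rewrite -/(@dg d p); have := mS _ _ hk; lia.
    - move=> a aA ap; have [j hj aj] := ha a aA ap; rewrite -/(@dg d p) -/(@dg d a) -/Lam.
      have := mS _ _ hj; move: aj; rewrite inE => /and3P[_ _ aj] hlt.
      apply: (@leq_trans (Lam * hi j d)); first by rewrite leq_mul2l aj orbT.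
      by lia.
    split=> //; apply: cp_mono hc => // i iS; by case: (sB' i iS).
  have hcmp i j : i \in Z -> j \in Z -> i != j -> U (fun d => lo i d <= Lam * hi j d).
    move=> iZ jZ ij; have ndec : ~ dec i j.
      have [hij|hji] := subseq2_total uZ iZ jZ ij.
        by have := hcol _ hij erefl; rewrite c2 /col /=; case: ifP => // /asboolP.
      have := hcol _ hji erefl; rewrite c2 /col /=; case: ifP => // _.
      by case: ifP => // /asboolP.
    by apply: (ultra1 hU (ultra_not hU ndec)) => d /negP; rewrite -leqNgt.
  have hZX i : i \in Z -> i \in X by exact: (mem_subseq ZX).
  have k0K : nth 0 K 0 \in K by exact: mem_nth.
  (* If hi vanished, the middle half of block j would be anticomplete to the part of HH in a block
     of K, against [coh]. *)
  have hi0 j : j \in Z -> U (fun d => 0 < hi j d).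
    move=> jZ; apply: contrapT => /(ultra_not hU) h0; set k0 := nth 0 K 0 in k0K.
    have jk : j != k0 by apply: XK => //; exact: hZX.
    pose A' d := [set x in B j d | lo j d <= @dg d x <= hi j d].
    pose HH' d := HH d :&: B k0 d.
    have [dj _] := bd j k0 (inX _ (hZX _ jZ)) (inK _ k0K) jk.
    apply: (@coh G A' HH').
    - apply: (@big_leM G (B j) _ 2); last by apply: bb; apply: inX; exact: hZX.
      by apply: ultraT hU _ _ => d; case: (hF j d).
    - apply: (@big_leM G (B k0) _ 2); last by apply: bb; exact: inK.
      by apply: (ultra1 hU hHH) => d [_ h2 _]; exact: h2.
    - move=> d; apply: disjointWr (subsetIr _ _) _; apply: disjointWl (dj d).
      by apply/subsetP => x; rewrite inE => /andP[].
    - apply: (ultra1 hU h0) => d hd x y; rewrite !inE => /and3P[_ _ hx] /andP[yH _].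
      apply/negP => exy; apply: hd; apply: leq_trans hx; rewrite /dg card_gt0.
      by apply/set0Pn; exists y; rewrite inE yH.
  pose Ks (sd : bool) := if sd then L else R.
  pose HS sd : fam G := fun d => HH d :&: \bigcup_(k <- Ks sd) B k d.
  (* A quarter of block j has degree at least hi into HH. Each such vertex sends at least half of
     that to L or to R, so one side serves an eighth of the block. *)
  have hside j : exists sd, j \in Z ->
      U (fun d => #|B j d| <= 8 * #|[set x in B j d | hi j d <= 2 * #|nb e x (HS sd d)|]|).
    have [jZ|] := boolP (j \in Z); last by exists true.
    have : U (fun d => (fun sd => #|B j d| <= 8 * #|[set x in B j d | hi j d <= 2 * #|nb e x (HS sd d)|]|) true
      \/ (fun sd => #|B j d| <= 8 * #|[set x in B j d | hi j d <= 2 * #|nb e x (HS sd d)|]|) false).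
      apply: (ultra1 hU hHH) => d [hsub _ _] /=.
      have [_ h2 _] := hF j d.
      have : #|[set x in B j d | (F j d).2 <= @dg d x]| <=
        #|[set x in B j d | hi j d <= 2 * #|nb e x (HS true d)|]| +
        #|[set x in B j d | hi j d <= 2 * #|nb e x (HS false d)|]|.
        apply: leq_trans (leq_card_setU _ _); apply/subset_leq_card/subsetP => x.
        rewrite !inE => /andP[-> hx] /=; rewrite -/(hi j d) in hx.
        have : @dg d x <= #|nb e x (HS true d)| + #|nb e x (HS false d)|.
          apply: leq_trans (leq_card_setU _ _); apply/subset_leq_card/subsetP => y.
          rewrite !inE => /andP[yH ->]; rewrite yH !andbT /=.
          by have := subsetP hsub _ yH; rewrite /K big_cat inE.
        lia.
      by lia.
    by move=> /(ultra_or hU) [hh|hh]; [exists true|exists false].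
  have [sd hsd] := dchoice hside.
  have [sg [Y [YZ szY hY]]] : exists sg Y, [/\ subseq Y Z, size Y = m & forall j, j \in Y -> sd j = sg].
    have hc : count sd Z + count (predC sd) Z = size Z by exact: count_predC.
    have szm : 2 * m <= size Z by rewrite szZ leq_maxr.
    have hY sg : m <= count (fun j => sd j == sg) Z ->
      exists sg Y, [/\ subseq Y Z, size Y = m & forall j, j \in Y -> sd j = sg].
      move=> hm; exists sg, (take m [seq j <- Z | sd j == sg]); split.
      - exact: subseq_trans (take_subseq _ _) (filter_subseq _ _).
      - by rewrite size_takel // size_filter.
      - by move=> j /mem_take; rewrite mem_filter => /andP[/eqP].
    have [h1|h1] := leqP m (count sd Z).
      by apply: (hY true); rewrite (eq_count (a2 := sd)) // => j; case: (sd j).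
    apply: (hY false); rewrite (eq_count (a2 := predC sd)); last by move=> j /=; case: (sd j).
    lia.
  have YX := subseq_trans YZ ZX.
  (* A cover from L contradicts the exclusion in the given order, one from R that in the reversed
     order; hence Y' is either Y or its reversal. *)
  have fin Y' l : Y' =i Y -> uniq Y' -> l \in Y' -> exists2 k, k \in Ks sg & coverable B k Y' l.
    move=> YY uY' lY; have YZ' j : j \in Y' -> j \in Z by rewrite YY => /(mem_subseq YZ).
    have KK k : k \in Ks sg -> k \in K by rewrite /Ks /K mem_cat; case: (sg) => ->; rewrite ?orbT.
    have ul : uniq (Ks sg).
      by move: us; rewrite !cat_uniq /Ks; case: (sg) => [/and3P[]//|/and5P[]].
    apply: (@comparable_coverable G B (Ks sg) Y' (HS sg) (hi l) Lam l) => //.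
    - rewrite cat_uniq ul uY' andbT /=; apply/hasPn => j jY.
      by apply/negP => /KK jK; have := XK _ _ jK (hZX _ (YZ' _ jY)); rewrite eqxx.
    - apply: (blk_mem _ hB) => j; rewrite mem_cat => /orP[/KK /inK//|/YZ' /hZX /inX//].
    - by move=> d; exact: subsetIr.
    - exact/hi0/YZ'.
    - by have := hsd l (YZ' _ lY); rewrite (hY l) // -YY.
    - move=> j jY jl; apply: (ultra1 hU (hcmp j l (YZ' _ jY) (YZ' _ lY) jl)) => d hd.
      have [h1 _ _] := hF j d; apply: (leq_trans h1); rewrite leq_mul2l /=.
      apply/subset_leq_card/subsetP => x; rewrite !inE => /andP[-> hx] /=.
      apply: leq_trans hd; apply: leq_trans hx; apply: subset_leq_card; apply: nbS.
      exact: subsetIl.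
  have uY := subseq_uniq YZ uZ.
  case: (sg) fin => fin.
    have [l lm hl] := kl; have [|||k kK hk] := fin Y (nth 0 Y l) => //.
      by apply: mem_nth; rewrite szY.
    apply: (hl (k :: Y)); rewrite /= ?szY //.
    rewrite -cat1s; apply: cat_subseq; first by rewrite sub1seq.
    by apply: subseq_trans YX (prefix_subseq _ _).
  have [l lm hl] := kr; have [|||k kK hk] := fin (rev Y) (nth 0 (rev Y) l).
  - by move=> j; rewrite mem_rev.
  - by rewrite rev_uniq.
  - by apply: mem_nth; rewrite size_rev szY.
  apply: (hl (k :: rev Y)); rewrite /= ?size_rev ?szY //.
  rewrite !rev_cat -cat1s -catA; apply: cat_subseq; first by rewrite sub1seq mem_rev.
  by apply: subseq_trans (prefix_subseq _ _); rewrite subseq_rev.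
(* A tree has at most sz vertices, so with this bound it touches at most an eighth of each block, as
   [process] demands. *)
have small : U (fun d => forall i, i \in X -> forall k, k \in K ->
    forall a, a \in B i d -> 8 * sz * #|nb e a (B k d)| <= #|B k d|).
  apply: (ultra_all hU) => i iX; apply: (ultra_all hU) => k kK.
  have [_ sp] := bd i k (inX _ iX) (inK _ kK) (XK _ _ kK iX).
  apply: (ultra1 hU (sp (8 * sz))) => d hd a /hd; apply: leq_trans.
  by rewrite leq_mul2r leq_wX orbT.
have pos : U (fun d => forall k, k \in K -> 0 < #|B k d|).
  by apply: (ultra_all hU) => k kK; apply/big_gt0/bb/inK.
have proc : U (fun d => exists2 kk : nat * nat * bool,
     kk \in [seq (x, b) | x <- [seq (i, j) | i <- K, j <- K], b <- [:: true; false]]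
   & exists GH : {set V d} * {set V d}, [/\ GH.1 \subset B kk.1.2 d,
      #|B kk.1.1 d| <= 18 * size K * #|GH.1|,
      forall j, j \in K -> #|B j d| <= 2 * #|GH.2 :&: B j d|
    & forall b, b \in GH.1 -> exists A p, [/\ cp kk.2 (v kk.2) sz B X A p, att e b A p & acomp e A GH.2]]).
  apply: (ultra3 hU claim small pos) => d hd1 hd2 hd3.
  have [|dl A p k hc kK|HH h1 h2|k [k' [dl [Gs [HH [h1 h2 h3 h4 [h5 h6]]]]]]] :=
     @process (V d) e (@ae_sym G d) K (fun k => B k d)
     (fun dl A p => cp dl (v dl) sz B X A p) _ _ _ K0 hd3.
  - by move=> dl A p [[hf _] _ _]; exact: full_mem hf.
  - have [hf cA [i [j0 [hi pi ha]]]] := hc.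
    have aX a : a \in A -> 8 * sz * #|nb e a (B k d)| <= #|B k d|.
      move=> aA; have [->|ap] := eqVneq a p.
        by apply: (hd2 i) => //; have [] := subseq2_mem hi; rewrite mem_ord.
      have [j hj aj] := ha a aA ap; apply: (hd2 j) => //.
      by have [] := subseq2_mem hj; rewrite !mem_ord.
    have tsub : touched e A (B k d) \subset \bigcup_(a in A) nb e a (B k d).
      apply/subsetP => x; rewrite inE => /andP[xB /existsP[a /andP[aA eax]]].
      by apply/bigcupP; exists a => //; rewrite inE xB.
    have ht := leq_trans (subset_leq_card tsub) (leq_card_bigcup_in _ _).
    have : 8 * sz * \sum_(a in A) #|nb e a (B k d)| <= sz * #|B k d|.
      apply: (@leq_trans (\sum_(a in A) #|B k d|)).
        by rewrite big_distrr /=; apply: leq_sum => a; exact: aX.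
      by rewrite sum_nat_const leq_mul2r cA orbT.
    have sz0 : 0 < sz.
      by apply: leq_trans cA; apply/card_gt0P; exists p; case: hf => /full_mem.
    rewrite [8 * sz]mulnC -mulnA leq_pmul2l // => h8.
    by apply: leq_trans h8; rewrite leq_mul2l.
  - exact: hd1.
  exists (k, k', dl); last by exists (Gs, HH).
  apply/allpairsP; exists ((k, k'), dl); split=> //=; last by case: (dl).
  by apply/allpairsP; exists (k, k').
have [[[k k'] dl] hkk hk] := ultra_exS hU proc.
case/allpairsP: hkk hk => -[[i j] b] /= [/allpairsP[[i' j'] /= [hi hj [-> ->]]] _ [-> -> ->]] hk.
have [GH hGH] := ultra_choice hU (fun d => (set0, set0)) hk; rewrite /= in hGH.
exists j', b; split=> //.
pose C k : fam G := fun d => if k == j' then (GH d).1 :&: B j' d else (GH d).2 :&: B k d.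
exists C; split.
  move=> x xK; rewrite /C; case: eqP => [->|_]; (split; first by move=> d; exact: subsetIr).
    apply: (@big_leM G (B i') _ (18 * size K)); last exact/bb/inK.
    by apply: (ultra1 hU hGH) => d [/setIidPl -> h2 _ _].
  apply: (@big_leM G (B x) _ 2); last exact/bb/inK.
  by apply: (ultra1 hU hGH) => d [_ _ h3 _]; exact: h3.
apply: (ultra1 hU hGH) => d [h1 h2 h3 h4] x; rewrite /C eqxx inE => /andP[/h4 [A [p [c1 c2 c3]]] _].
exists A, p; split=> // y yK yj a z aA; rewrite (negbTE yj) inE => /andP[zH _].
exact: c3.
Qed.

End Attach.

(** * Growing trees *)

Section Merge.
Variable G : asym.
Local Notation U := (aU G).
Local Notation hU := (aU_ultra G).
Local Notation V := (aV G).
Local Notation e := (@ae G _).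
Local Notation m := (am G).
Implicit Types (B C : nat -> fam G) (s S X Y L R Z : seq nat).

Lemma cp_loc dl v sz B X d (A : {set V d}) p a :
  cp dl v sz B X A p -> a \in A -> exists2 j, j \in X & a \in B j d.
Proof.
move=> [_ _ [k [j0 [hk pk ha]]]] aA; have [->|ap] := eqVneq a p.
  by exists k => //; have [] := subseq2_mem hk; rewrite mem_ord.
by have [j hj aj] := ha a aA ap; exists j => //; have [] := subseq2_mem hj; rewrite !mem_ord.
Qed.

Lemma cp_mem dl v sz B X d (A : {set V d}) p : cp dl v sz B X A p -> p \in A.
Proof. by case=> [[/full_mem]]. Qed.

Lemma blk_disj B s i j d (x y : V d) : blk B s -> i \in s -> j \in s -> i != j ->
  x \in B i d -> y \in B j d -> x != y.
Proof.
move=> [_ hd] si sj ij xi yj; have [dd _] := hd i j si sj ij.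
by apply: contraTneq yj => <-; rewrite (disjointFr (dd d) xi).
Qed.

(** The hub is given by its position in the two outer segments, so that the possible outcomes form a
    finite set independent of S and can serve as Ramsey colours. *)
Definition attach_at v sz B N n S i0 dl :=
  attach v sz B (take N S) (take n (drop N S)) (drop (N + n) S)
    (nth 0 (take N S ++ drop (N + n) S) i0) dl.

Lemma attach_atE v sz B N n L X R i0 dl : size L = N -> size X = n ->
  attach_at v sz B N n (L ++ X ++ R) i0 dl = attach v sz B L X R (nth 0 (L ++ R) i0) dl.
Proof.
move=> <- <-.
by rewrite /attach_at take_size_cat // drop_size_cat // take_size_cat // catA -size_cat drop_size_cat.
Qed.

Section Hub.
Variables (v : bool -> nat) (sz N n i0 : nat) (dl : bool) (B : nat -> fam G) (s : seq nat).
Hypothesis us : uniq s.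
Hypothesis hB : blk B s.
Hypothesis i0N : i0 < N.
Hypothesis rob : forall S B', subseq S s -> size S = N + n + N -> shr B' B s ->
  attach_at v sz B' N n S i0 dl.

Let copies d B' b Z c (cs : seq ({set V d} * V d)) := [/\ size cs = c,
  forall x, x \in cs -> cp dl (v dl) sz B' Z x.1 x.2 /\ att e b x.1 x.2
  & pairwise (fun x y => apart e x.1 y.1) cs].

(** Trees are attached to the same hub one after the other, each in n fresh blocks, and the hub
    shrinks every time. Each tree is anticomplete to the shrunk blocks in which the later ones are
    found, so the trees at one hub vertex are pairwise apart. *)
Lemma hub_copies c L Z X R B' : subseq (L ++ Z ++ X ++ R) s -> size L = N -> size Z = c * n ->
  size X = n -> size R = N -> c * n + n <= N -> shr B' B s ->
  exists H : fam G, [/\ sub H (B' (nth 0 L i0)), big H & U (fun d => forall b, b \in H d ->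
    exists cs A p, [/\ copies B' b Z c cs, cp dl (v dl) sz B' X A p, att e b A p
      & forall x, x \in cs -> apart e A x.1])].
Proof.
elim: c Z B' => [|c IH] Z B' hS szL szZ szX szR hN sB'.
  rewrite mul0n in szZ; move/size0nil: szZ hS => -> /= hS.
  have := rob hS _ sB'; rewrite attach_atE // !size_cat szL szX szR addnA => /(_ erefl).
  case=> kK [C [sC hC]]; have kE : nth 0 (L ++ R) i0 = nth 0 L i0 by rewrite nth_cat szL i0N.
  rewrite kE in kK hC; have [sCk bCk] := sC _ kK.
  exists (C (nth 0 L i0)); split=> //; apply: (ultra1 hU hC) => d hd b /hd [A [p [h1 h2 _]]].
  by exists [::], A, p; split.
set X1 := take n Z; set Z' := drop n Z.
have ZE : Z = X1 ++ Z' by rewrite cat_take_drop.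
have szX1 : size X1 = n by rewrite size_takel // szZ mulSn leq_addr.
have szZ' : size Z' = c * n by rewrite size_drop szZ mulSn addKn.
(* These N blocks include all of Z' and X, so the tree found in X1 will miss every block still to be
   used for trees. *)
set R1 := take N (Z' ++ X ++ R).
have szR1 : size R1 = N by rewrite size_takel // !size_cat szR; lia.
have R1E : exists R2, R1 = Z' ++ X ++ R2.
  exists (take (N - (c * n + n)) R); rewrite /R1 catA take_cat size_cat szZ' szX.
  by rewrite ifN ?catA //; rewrite -leqNgt; move: hN; rewrite mulSn; lia.
have S1s : subseq (L ++ X1 ++ R1) s.
  apply: subseq_trans hS; rewrite ZE -catA; do 2 (apply: cat_subseq => //).
  exact: take_subseq.
have := rob S1s _ sB'; rewrite attach_atE // !size_cat szL szX1 szR1 addnA.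
move=> /(_ erefl) [kK [C [sC hC]]].
have kE : nth 0 (L ++ R1) i0 = nth 0 L i0 by rewrite nth_cat szL i0N.
rewrite kE in kK hC; set k := nth 0 L i0 in kK hC *.
have b' := blk_shr sB' hB.
have LRs : {subset L ++ R1 <= s}.
  move=> i; rewrite mem_cat => hi; apply: (mem_subseq S1s); rewrite !mem_cat.
  by case/orP: hi => ->; rewrite ?orbT.
set B'' := patch (L ++ R1) C B'.
have sB'' : shr B'' B' s by exact: shr_patch.
have hS' : subseq (L ++ Z' ++ X ++ R) s.
  apply: subseq_trans hS; rewrite ZE -catA; apply: cat_subseq => //; exact: suffix_subseq.
have hN' : c * n + n <= N by move: hN; rewrite mulSn; lia.
have [H [sH bH hH]] := IH Z' B'' hS' szL szZ' szX szR hN' (shr_trans sB'' sB').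
have kL : k \in L by rewrite mem_nth // szL.
have B''k : B'' k = C k by rewrite /B'' /patch mem_cat kL.
exists H; split=> //.
  by move=> d; apply: subset_trans (sH d) _; case: (sB'' k (LRs _ kK)).
have [R2 R1E'] := R1E.
have uS1 := subseq_uniq S1s us.
have uXR : uniq (X1 ++ R1) by move: uS1; rewrite cat_uniq => /and3P[].
have kR1 j : j \in R1 -> j != k.
  move=> jR; apply: contraTneq uS1 => jk; rewrite cat_uniq; apply/negP => /and3P[_ /hasP h _].
  by apply: h; exists j; rewrite ?mem_cat ?jR ?orbT // jk.
apply: (ultra2 hU hC hH) => d hd1 hd2 b bH'.
have bC : b \in C k d by rewrite -B''k; exact: (subsetP (sH d)).
have [A1 [p1 [c1 t1 a1]]] := hd1 b bC.
have [cs [A [p [[h1 h2 h3] h4 h5 h6]]]] := hd2 b bH'.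
have subS Y : {subset Y <= s} -> forall i, i \in Y -> sub (B'' i) (B' i).
  by move=> hY i /hY /sB'' [].
have mZ' : {subset Z' <= R1} by move=> i; rewrite R1E' mem_cat => ->.
have mX : {subset X <= R1} by move=> i; rewrite R1E' !mem_cat => ->; rewrite orbT.
have R1s : {subset R1 <= s} by move=> i hi; apply: LRs; rewrite mem_cat hi orbT.
have ap (A' : {set V d}) Y : {subset Y <= R1} ->
   (forall a, a \in A' -> exists2 j, j \in Y & a \in B'' j d) -> apart e A1 A'.
  move=> YR hA'; apply/forall_inP => x xA; apply/forall_inP => y yA.
  have [i iX xi] := cp_loc c1 xA; have [j jY yj] := hA' y yA.
  have jR := YR _ jY; have yC : y \in C j d.
    by move: yj; rewrite /B'' /patch mem_cat jR orbT.
  apply/andP; split; last by apply: (a1 j) => //; [rewrite mem_cat jR orbT | exact: kR1].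
  have X1s : i \in s by apply: (mem_subseq S1s); rewrite !mem_cat iX orbT.
  apply: (blk_disj b' X1s (R1s _ jR) _ xi).
    apply: contraTneq uXR => ij; rewrite cat_uniq; apply/negP => /and3P[_ /hasP h _].
    by apply: h; exists j => //; rewrite -ij.
  by apply: (subsetP _ _ yC); case: (sC j); rewrite // mem_cat jR orbT.
have apC (X' Y' : {set V d}) : apart e X' Y' -> apart e Y' X'.
  move=> /forall_inP h; apply/forall_inP => y yY; apply/forall_inP => x xX.
  by have /forall_inP /(_ y yY) := h x xX; rewrite eq_sym ae_sym.
exists ((A1, p1) :: cs), A, p; split=> //.
- split; first by rewrite /= h1.
    move=> x; rewrite inE => /orP[/eqP->/=|/h2 [c2 t2]]; split=> //.
      by apply: cp_mono c1 => //; [rewrite ZE prefix_subseq | move=> i _ d'; exact: subxx].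
    apply: cp_mono c2 => //; first by rewrite ZE suffix_subseq.
    by apply: subS => i /mZ' /R1s.
  rewrite /= h3 andbT; apply/allP => x /h2 [c2 _] /=.
  by apply: (ap _ Z' mZ') => a; exact: cp_loc c2.
- by apply: cp_mono h4 => //; apply: subS => i /mX /R1s.
- move=> x; rewrite inE => /orP[/eqP->/=|]; last exact: h6.
  by apply: apC; apply: (ap _ X mX) => a; exact: cp_loc h4.
Qed.

Lemma subseq2_cat i j X Y : i \in X -> j \in Y -> subseq [:: i; j] (X ++ Y).
Proof. by move=> iX jY; rewrite -cat1s; apply: cat_subseq; rewrite sub1seq. Qed.

(** In the total order b comes first, then the m trees, then A. With the m trees as branches, b is
    the root of a tree one level deeper. *)
Lemma merge_copies d B' k L Z X R b cs (A : {set V d}) p :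
  subseq (L ++ Z ++ X ++ R) s -> shr B' B (L ++ Z ++ X ++ R) -> k \in L -> b \in B' k d ->
  copies B' b Z m cs -> cp dl (v dl) sz B' X A p -> att e b A p ->
  (forall x, x \in cs -> apart e A x.1) ->
  exists (A' : {set V d}) p', cp dl (v dl).+1 (m.+1 * sz).+1 B' (L ++ Z ++ X ++ R) A' p'.
Proof.
set S := L ++ Z ++ X ++ R.
move=> hS sB' kL bk [szcs hcs pw] cA /andP[ebp /forall_inP attA] apA.
have uS := subseq_uniq hS us.
have bS : blk B' S := blk_shr sB' (blk_mem (mem_subseq hS) hB).
have m0 := am0 G.
pose F := \bigcup_(x in [set x in cs]) x.1; pose Ab := b |: F.
have inF x y : x \in cs -> y \in x.1 -> y \in F.
  by move=> xcs yx; apply/bigcupP; exists x; rewrite ?inE.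
have FP y : y \in F -> exists2 x, x \in cs & y \in x.1.
  by case/bigcupP => x; rewrite inE => xcs yx; exists x.
have LZ j : j \in Z -> subseq [:: k; j] S.
  by move=> jZ; apply: subseq2_cat => //; rewrite mem_cat jZ.
have LX j : j \in X -> subseq [:: k; j] S.
  by move=> jX; apply: subseq2_cat => //; rewrite !mem_cat jX orbT.
have ZX i j : i \in Z -> j \in X -> subseq [:: i; j] S.
  move=> iZ jX; apply: subseq_trans (suffix_subseq _ _); apply: subseq2_cat => //.
  by rewrite mem_cat jX.
have FZ y : y \in F -> exists2 j, j \in Z & y \in B' j d.
  by move=> /FP [x /hcs [cx _] yx]; exact: cp_loc cx yx.
have sepS i j (x y : V d) : subseq [:: i; j] S -> x \in B' i d -> y \in B' j d -> x != y.
  by move=> hij; have [iS jS] := subseq2_mem hij; apply: (blk_disj bS iS jS (subseq2_neq uS hij)).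
have bF : b \notin F.
  by apply/negP => bF; have [j jZ bj] := FZ b bF; have := sepS _ _ _ _ (LZ j jZ) bk bj; rewrite eqxx.
have bA a : a \in A -> b != a.
  by move=> aA; have [j jX aj] := cp_loc cA aA; exact: sepS (LX j jX) bk aj.
have fullb : full e m (v dl %/ m).+1 Ab b.
  split; first by rewrite !inE eqxx.
  exists cs; split=> //; last by move=> x /hcs [[[hf _] _ _] _].
  apply/andP; split=> //; apply/allP => x xcs; have [cx /andP[ebx /forall_inP ax]] := hcs x xcs.
  have px := cp_mem cx; apply/and4P; split=> //.
  - by apply/subsetP => y yx; rewrite inE (inF _ _ xcs yx) orbT.
  - by apply: contraNN bF; exact: inF.
  - apply/forall_inP => y yx; have [->|yn] := eqVneq y x.2; first by rewrite ebx.
    by have := ax y yx; rewrite yn => /negbTE ->.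
have cAb : #|Ab| <= (m * sz).+1.
  rewrite /Ab cardsU1 bF add1n ltnS.
  apply: leq_trans (leq_card_bigcup_in _ _) _.
  apply: (@leq_trans (\sum_(x in [set x in cs]) sz)).
    by apply: leq_sum => x; rewrite inE => /hcs [[_ cx _] _].
  rewrite sum_nat_const leq_mul2r; apply/orP; right; rewrite cardsE -szcs; exact: card_size.
have [pX jX pjX] := cp_loc cA (cp_mem cA).
have [fA szA [kp [j0 [hk pk hA]]]] := cA.
(* If the root has to come first, the tree at b is the new tree. If it has to come last, the tree at
   b becomes a new branch at the root p of A, whose block lies after those of b and of its trees. *)
case: (dl) fA hk hA fullb => /= fA hk hA fullb.
  exists Ab, b; split; first exact: full_ofullS.
    by apply: leq_trans cAb _; rewrite mulSn ltnS leq_addl.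
  exists k, pX; split=> //; first exact: LX.
  move=> a; rewrite !inE => /orP[/eqP->|aF]; first by rewrite eqxx.
  by move=> _; have [j jZ aj] := FZ a aF; exists j => //; exact: LZ.
have kpX : kp \in X by have [] := subseq2_mem hk; rewrite mem_rev.
have pAb : p \notin Ab.
  rewrite !inE negb_or eq_sym bA ?(cp_mem cA) //=; apply/negP => pF.
  by have [j jZ pj] := FZ p pF; have := sepS _ _ _ _ (ZX _ _ jZ kpX) pj pk; rewrite eqxx.
have XS : subseq X S.
  apply: subseq_trans (suffix_subseq _ _); apply: subseq_trans (suffix_subseq _ _).
  exact: prefix_subseq.
exists (A :|: Ab), p; split.
- apply: (@ofull_addchild _ _ (@ae_sym G d) m m0 _ A _ p (Ab, b)) => //.
  + exact: subsetUl.
  + apply/and4P; split=> //=; [exact: subsetUr | by rewrite !inE eqxx | ].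
    apply/forall_inP => x; rewrite !inE => /orP[/eqP->|xF]; first by rewrite ae_sym ebp eqxx.
    have [y ycs xy] := FP x xF; have /forall_inP /(_ p (cp_mem cA)) /forall_inP /(_ x xy) := apA y ycs.
    move=> /andP[_ /negbTE ->]; rewrite (_ : (x == b) = false) //; apply/negbTE.
    by apply: contraNneq bF => <-.
  + move=> x y xA; rewrite !inE => /orP[/eqP->|yF].
      have [xp|xp] := eqVneq x p; [by left | right].
      by rewrite eq_sym bA // ae_sym; have := attA x xA; rewrite xp.
    right; have [z zcs yz] := FP y yF.
    by have /forall_inP /(_ x xA) /forall_inP /(_ y yz) := apA z zcs.
  + exact: fullW.
- apply: leq_trans (leq_card_setU _ _) _; rewrite mulSn -addnS; exact: leq_add.
- exists kp, k; split=> //.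
    by rewrite -subseq_rev revK; exact: LX.
  move=> a; rewrite !inE => /or3P[aA|/eqP->|aF] ap.
  + have [j hj aj] := hA a aA ap; exists j => //; apply: subseq_trans hj _.
    by rewrite subseq_rev.
  + by exists k => //; rewrite -subseq_rev revK; exact: LX.
  + have [j jZ aj] := FZ a aF; exists j => //.
    by rewrite -subseq_rev revK; exact: ZX.
Qed.

Lemma merge_left : m * n + n <= N -> unavoidable dl (v dl).+1 (m.+1 * sz).+1 (N + (m * n + n) + N) B s.
Proof.
move=> hN S B' hS szS sB'.
pose D := drop N S; pose D2 := drop (m * n) D.
have SE : S = take N S ++ take (m * n) D ++ take n D2 ++ drop n D2.
  by rewrite !cat_take_drop.
have szD : size D = m * n + n + N by rewrite size_drop szS; lia.
have szD2 : size D2 = n + N by rewrite size_drop szD; lia.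
have hB' : shr (patch S B' B) B s by apply: (shr_patch hB (mem_subseq hS)).
have patchE i : i \in S -> patch S B' B i = B' i by rewrite /patch => ->.
have hS' := hS; rewrite SE in hS'.
have sB2 : shr B' B (take N S ++ take (m * n) D ++ take n D2 ++ drop n D2) by rewrite -SE.
have [||||H [sH bH hH]] := @hub_copies m _ _ _ _ (patch S B' B) hS' _ _ _ _ hN hB'.
- by rewrite size_takel // szS; lia.
- by rewrite size_takel // szD; lia.
- by rewrite size_takel // szD2; lia.
- by rewrite size_drop szD2 addKn.
have kL : nth 0 (take N S) i0 \in take N S by rewrite mem_nth // size_takel // szS; lia.
have inS X : {subset X <= S} -> forall i, i \in X -> sub (patch S B' B i) (B' i).
  by move=> hX i /hX iS; rewrite patchE // => d; exact: subxx.
have mZ : {subset take (m * n) D <= S} by move=> i /mem_take /mem_drop.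
have mX : {subset take n D2 <= S} by move=> i /mem_take /mem_drop /mem_drop.
apply: (ultra2 hU hH (big_gt0 bH)) => d hd; rewrite card_gt0 => /set0Pn[b bHd].
have [cs [A [p [[h1 h2 h3] h4 h5 h6]]]] := hd b bHd.
rewrite [X in cp _ _ _ _ X]SE.
apply: (merge_copies (k := nth 0 (take N S) i0) (b := b) (cs := cs) (p := p) (A := A)) => //.
- by rewrite -(patchE _ (mem_take kL)); exact: (subsetP (sH d)).
- split=> // x /h2 [c2 t2]; split=> //; apply: cp_mono c2 => //; exact: inS.
- by apply: cp_mono h4 => //; exact: inS.
Qed.

End Hub.

Lemma cp_rev dl v sz B X d (A : {set V d}) p :
  cp dl v sz B X A p -> cp (~~ dl) v sz B (rev X) A p.
Proof. by case: dl => -[h1 h2 h3]; split=> //=; rewrite ?revK. Qed.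

Lemma unavoidable_rev dl v sz N B s : unavoidable dl v sz N B s -> unavoidable (~~ dl) v sz N B (rev s).
Proof.
move=> hp S B' hS szS sB'; have hS' : subseq (rev S) s by rewrite -subseq_rev revK.
apply: (ultra1 hU (hp (rev S) B' hS' _ _)).
- by rewrite size_rev.
- by apply: shr_mem sB' => i; rewrite mem_rev.
by move=> d [A [p /cp_rev]]; rewrite revK => hc; exists A, p.
Qed.

Lemma attach_rev v sz B L X R k dl : attach v sz B L X R k dl ->
  attach (fun b => v (~~ b)) sz B (rev R) (rev X) (rev L) k (~~ dl).
Proof.
have mE i : (i \in rev R ++ rev L) = (i \in L ++ R) by rewrite -rev_cat mem_rev.
move=> [kK [C [sC hC]]]; split; first by rewrite mE.
exists C; split; first by move=> i; rewrite mE; exact: sC.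
apply: (ultra1 hU hC) => d hd b /hd [A [p [h1 h2 h3]]]; exists A, p; split=> //.
  by rewrite negbK; exact: cp_rev.
by move=> j; rewrite mE; exact: h3.
Qed.

(** A hub to the right of the trees is moved to the left by reversing everything, which also
    exchanges the two directions; position i0 becomes 2N - i0 - 1. *)
Lemma merge v sz N n i0 dl B s : uniq s -> blk B s -> i0 < 2 * N -> m * n + n <= N ->
  (forall S B', subseq S s -> size S = N + n + N -> shr B' B s -> attach_at v sz B' N n S i0 dl) ->
  unavoidable dl (v dl).+1 (m.+1 * sz).+1 (N + (m * n + n) + N) B s.
Proof.
move=> us hB hi hN rob; have [iN|Ni] := ltnP i0 N; first exact: merge_left rob hN.
rewrite -[dl]negbK -[s]revK; apply: unavoidable_rev.
apply: (@merge_left (fun b => v (~~ b)) sz N n (2 * N - i0.+1)) => //.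
- by rewrite rev_uniq.
- by apply: blk_mem hB => i; rewrite mem_rev.
- by lia.
move=> S B' hS szS sB'.
have hS' : subseq (rev S) s by rewrite -subseq_rev revK.
have sB2 : shr B' B s by apply: shr_mem sB' => i; rewrite mem_rev.
have := rob (rev S) B' hS'; rewrite size_rev => /(_ szS sB2) /attach_rev.
rewrite /attach_at.
have -> : rev (drop (N + n) (rev S)) = take N S.
  by rewrite drop_rev revK; congr take; rewrite szS; lia.
have -> : rev (take n (drop N (rev S))) = take n (drop N S).
  have hsz : size (take (N + n) S) = N + n by rewrite size_takel // szS; lia.
  by rewrite drop_rev take_rev revK szS addnK hsz addnK take_drop addnC.
have -> : rev (take N (rev S)) = drop (N + n) S.
  by rewrite take_rev revK; congr drop; rewrite szS; lia.
suff -> : nth 0 (take N (rev S) ++ drop (N + n) (rev S)) i0 =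
   nth 0 (take N S ++ drop (N + n) S) (2 * N - i0.+1) by [].
have -> : take N (rev S) ++ drop (N + n) (rev S) = rev (take N S ++ drop (N + n) S).
  rewrite rev_cat take_rev drop_rev szS; congr (rev _ ++ rev _).
    by congr drop; lia.
  by congr take; lia.
have sz2 : size (take N S ++ drop (N + n) S) = 2 * N.
  by rewrite size_cat size_drop size_takel szS; lia.
by rewrite nth_rev sz2.
Qed.

End Merge.

(** * Iterating the growth step *)

Section Growth.
Variable G : asym.
Local Notation hU := (aU_ultra G).
Local Notation e := (@ae G _).
Local Notation m := (am G).
Implicit Types (B C : nat -> fam G) (s S X Y L R Z : seq nat).

Definition ready_at v sz N M := exists B s, [/\ uniq s, size s = M, blk B s,
  killed B s /\ killed B (rev s) & forall dl, unavoidable dl (v dl) sz N B s].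

Definition ready v := exists N sz, forall M, ready_at v sz N M.

Lemma ready_take v sz N M M' : M <= M' -> ready_at v sz N M' -> ready_at v sz N M.
Proof.
move=> hM [B [s [us ss hB [k1 k2] hp]]]; exists B, (take M s).
have ts := take_subseq s M.
have hB' := blk_mem (mem_subseq ts) hB.
split=> //; first exact: subseq_uniq ts us.
- by rewrite size_takel // ss.
- split; first exact: killed_mono ts (shr_refl hB') k1.
  apply: (killed_mono (s := rev s)) k2; first by rewrite subseq_rev.
  by apply: shr_refl; apply: blk_mem hB' => i; rewrite mem_rev.
- by move=> dl; apply: unavoidable_mono (hp dl) => //; exact: shr_refl.
Qed.

Lemma ready0 : ready (fun=> 0).
Proof.
exists 2, 1 => M; have [B [s [us ss hB k1 k2]]] := killed_blockade G M.
exists B, s; split=> // dl S B' hS szS sB'.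
have [k [j0 hkj]] : exists k j0, ord dl S = [:: k; j0].
  have : size (ord dl S) = 2 by case: dl; rewrite //= size_rev.
  by case: (ord dl S) => [|k [|j0 [|]]] // _; exists k, j0.
have kS : k \in S by rewrite -(mem_ord dl) hkj mem_head.
have [_ bk] := sB' k kS.
apply: (ultra1 hU (big_gt0 bk)) => d; rewrite card_gt0 => /set0Pn[p pk].
exists [set p], p; split; last first.
- exists k, j0; rewrite hkj; split=> // a; rewrite inE => /eqP->; by rewrite eqxx.
- by rewrite cards1.
rewrite /ofull div0n mod0n; split; first by rewrite /= inE.
by exists [::]; split.
Qed.

Lemma attach_mono v sz B B' L X R k dl : shr B' B (L ++ X ++ R) ->
  attach v sz B' L X R k dl -> attach v sz B L X R k dl.
Proof.
move=> sB [kK [C [sC hC]]]; split=> //; exists C; split.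
  apply: shr_trans sC (shr_mem _ sB) => i; rewrite !mem_cat => /orP[->|->]; rewrite ?orbT //.
apply: (ultra1 hU hC) => d hd b /hd [A [p [c1 c2 c3]]]; exists A, p; split=> //.
by apply: cp_mono c1 => // i iX; case: (sB i); rewrite // !mem_cat iX orbT.
Qed.

Lemma cat3_take_drop N n (S : seq nat) : take N S ++ take n (drop N S) ++ drop (N + n) S = S.
Proof. by rewrite addnC -drop_drop !cat_take_drop. Qed.

Lemma attach_at_mono v sz B B' N n S i0 dl : shr B' B S ->
  attach_at v sz B' N n S i0 dl -> attach_at v sz B N n S i0 dl.
Proof. by move=> sB; apply: attach_mono; rewrite cat3_take_drop. Qed.

(** For each subsequence of length r, [core] gives a hub position and a direction. [decide] makes
    the outcomes stable under shrinking, Ramsey's theorem makes one of them common to all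
    subsequences of a long part, and [merge] applies there. *)
Lemma grow v sz N : (forall M, ready_at v sz N M) -> exists sz' N', forall M,
  exists dl, ready_at (fun b => v b + (b == dl)) sz' N' M.
Proof.
move=> hr; have [n hcore] := core G v sz N.
(* [merge] needs at least m * n + n blocks on each side; the extra 1 makes [L ++ R] nonempty even
   when n is 0. *)
pose N0 := m * n + n + 1; pose r := N0 + n + N0.
pose sz' := (m.+1 * sz).+1; pose N' := maxn N (N0 + (m * n + n) + N0).
exists sz', N' => M.
pose codes := [seq (i, b) | i <- iota 0 (2 * N0), b <- [:: true; false]].
have [K hK] := ramsey r (size codes).+1 (maxn M r).
have [B [s [us ss hB [k1 k2] hp]]] := hr K.
pose P (x : seq nat * (nat * bool)) B := size x.1 = r /\ attach_at v sz B N0 n x.1 x.2.1 x.2.2.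
pose l := [seq (x, y) | x <- subseqs s, y <- codes].
have [|B' [sB' hB']] := @decide G _ l P B s hB.
  move=> [x y] B1 B2 /allpairsP[[x' y'] /= [hx _ [-> _]]] s12 [szx ha]; split=> //.
  apply: attach_at_mono ha; apply: shr_mem s12; apply: mem_subseq.
  by rewrite -mem_subseqs.
have b' := blk_shr sB' hB.
have ex S : subseq S s -> size S = r -> has (fun y => `[< P (S, y) B' >]) codes.
  move=> hS szS; have uS := subseq_uniq hS us.
  have sBS : shr B' B S by exact: shr_mem (mem_subseq hS) sB'.
  have hXS : subseq (take n (drop N0 S)) S by apply: subseq_trans (take_subseq _ _) (drop_subseq _ _).
  have s1 : size (take N0 S) = N0 by rewrite size_takel // szS /r; lia.
  have s2 : size (drop (N0 + n) S) = N0 by rewrite size_drop szS addKn.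
  have [||||dl|||k [dl hat]] := hcore B' (take N0 S) (take n (drop N0 S)) (drop (N0 + n) S).
  - by rewrite cat3_take_drop.
  - by rewrite cat3_take_drop; exact: blk_mem (mem_subseq hS) b'.
  - by rewrite cat3_take_drop; exact: killed_mono hS sBS k1.
  - rewrite cat3_take_drop; apply: (killed_mono (s := rev s)) k2; first by rewrite subseq_rev.
    by move=> i; rewrite mem_rev; exact: sBS.
  - apply: unavoidable_mono (hp dl) => //; first exact: subseq_trans hS.
    by apply: shr_mem sBS; exact: mem_subseq.
  - by rewrite size_takel // size_drop szS /r; lia.
  - by rewrite size_cat s1 /N0; lia.
  have [kK _] := hat; apply/hasP; exists (index k (take N0 S ++ drop (N0 + n) S), dl).
    apply/allpairsP; exists (index k (take N0 S ++ drop (N0 + n) S), dl); split=> //=.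
      by rewrite mem_iota /= add0n; move: kK; rewrite -index_mem size_cat s1 s2; lia.
    by case: dl {hat}.
  by apply/asboolP; split=> //=; rewrite /attach_at nth_index.
pose col S := find (fun y => `[< P (S, y) B' >]) codes.
have colm S : col S < (size codes).+1 by rewrite ltnS find_size.
have [hh [k [_ hs szh hcol]]] := hK s col (eq_leq (esym ss)) colm.
have kc : k < size codes.
  have ts : subseq (take r hh) hh := take_subseq _ _.
  have szt : size (take r hh) = r by rewrite size_takel // szh leq_maxr.
  by rewrite -(hcol _ ts szt) -has_find; apply: ex => //; exact: subseq_trans hs.
have bh := blk_mem (mem_subseq hs) b'.
have sBh : shr B' B hh := shr_mem (mem_subseq hs) sB'.
case E : (nth (0, true) codes k) => [i0 dl].
have cin : (i0, dl) \in codes by rewrite -E mem_nth.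
have iN : i0 < 2 * N0.
  by case/allpairsP: cin => -[i b] /= [hi _ [-> _]]; move: hi; rewrite mem_iota.
have rob S B2 : subseq S hh -> size S = r -> shr B2 B' hh -> attach_at v sz B2 N0 n S i0 dl.
  move=> hS szS sB2; have hSs := subseq_trans hS hs.
  have := ex S hSs szS; move=> /(nth_find (0, true)); rewrite -/(col S) (hcol _ hS szS) E => /asboolP hP.
  have [|[]//|robP] := hB' (S, (i0, dl)).
    by apply/allpairsP; exists (S, (i0, dl)); rewrite /= mem_subseqs hSs.
  have [|_] := robP (patch hh B2 B'); first by apply: shr_patch => //; exact: mem_subseq.
  apply: attach_at_mono => i iS; have ih := mem_subseq hS iS.
  by rewrite /patch ih; split; [move=> d; exact: subxx | case: (sB2 i ih)].
have hm : m * n + n <= N0 by rewrite /N0; lia.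
have uh := subseq_uniq hs us.
have hpres := merge uh bh iN hm rob.
exists dl; apply: (@ready_take _ _ _ M (maxn M r)); first exact: leq_maxl.
exists B', hh; split=> //.
  split; first exact: killed_mono hs sBh k1.
  apply: (killed_mono (s := rev s)) k2; first by rewrite subseq_rev.
  by move=> i; rewrite mem_rev; exact: sBh.
move=> b; have [->|bdl] := eqVneq b dl.
  by rewrite addn1; apply: unavoidable_mono hpres => //; [exact: leq_maxr | exact: shr_refl].
rewrite addn0; apply: unavoidable_mono (hp b) => //; last exact: leq_maxl.
by rewrite /sz' mulSn; lia.
Qed.

(** The direction given by [grow] may depend on M. If one direction fails for some length, it fails
    for all longer ones by [ready_take], so the other direction serves every length. *)
Lemma ready_step v : ready v -> exists dl, ready (fun b => v b + (b == dl)).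
Proof.
move=> [N [sz /grow [sz' [N' hg]]]].
have [hT|hF] := pselect (forall M, ready_at (fun b => v b + (b == true)) sz' N' M).
  by exists true, N', sz'.
exists false, N', sz' => M; apply: contrapT => hM; apply: hF => M'.
have [dl hdl] := hg (maxn M M'); case: dl hdl => hdl.
  by apply: ready_take hdl; exact: leq_maxr.
by case: hM; apply: ready_take hdl; exact: leq_maxl.
Qed.

Lemma asym_false : False.
Proof.
have m0 := am0 G.
have hready t : exists2 v : bool -> nat, ready v & t <= v true + v false.
  elim: t => [|t [v hv ht]]; first by exists (fun=> 0) => //; exact: ready0.
  have [dl hdl] := ready_step hv; exists (fun b => v b + (b == dl)) => //.
  by case: dl {hdl} => /=; lia.
(* One direction then has value at least m * m, which means a tree of depth m and branching m. *)
have [v [N [sz hr]] hv] := hready (2 * (m * m)).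
have [dl hdl] : exists dl, m * m <= v dl.
  by have [h|h] := leqP (m * m) (v true); [exists true|exists false; lia].
have [B [s [us ss hB _ hp]]] := hr N.
have [d [A [p [[hf _] _ _]]]] := ultra_ex hU (hp dl s B (subseq_refl s) ss (shr_refl hB)).
have hfm : full e m m A p by apply: full_leq hf; rewrite leq_divRL.
have [f hF] := full_tree (@ae_sym G d) (@ae_irr G d) (@apar_lt G) (leqnn _) m0 hfm.
exact: (a_noemb hF).
Qed.

End Growth.

Local Open Scope ring_scope.

(** * Hall ratios *)

Lemma psi_le_rho (G : sgraph) (S : {set G}) : psi (induced S) <= rho G.
Proof. exact: le_bigmax. Qed.

Lemma card_induced (G : sgraph) (S : {set G}) : #|induced S| = #|S|.
Proof. exact: card_sig. Qed.

Lemma rho_attained (G : sgraph) : exists S : {set G}, rho G = psi (induced S).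
Proof.
have [S _ hS] := arg_maxP (fun S : {set G} => psi (induced S)) (isT : predT (set0 : {set G})).
exists S; apply/eqP; rewrite eq_le psi_le_rho andbT; apply/bigmax_leP; split=> [|S' _].
  by rewrite /psi; case: ifP => // _; apply: divr_ge0; exact: ler0n.
exact: hS.
Qed.

Lemma leq_alpha (H K : sgraph) (f : H -> K) : injective f ->
  (forall x y, adj (f x) (f y) = adj x y) -> (alpha H <= alpha K)%N.
Proof.
move=> finj fadj; apply/bigmax_leqP => S /forall_inP hS.
rewrite -(card_imset _ finj); apply: leq_bigmax_cond; apply/forall_inP => _ /imsetP[x xS ->].
apply/forall_inP => _ /imsetP[y yS ->]; rewrite fadj.
by have /forall_inP /(_ y yS) := hS x xS.
Qed.

Lemma alpha_gt0 (H : sgraph) : (0 < #|H|)%N -> (0 < alpha H)%N.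
Proof.
case/card_gt0P => x _; rewrite -(cards1 x); apply: leq_bigmax_cond.
by apply/forall_inP => a /set1P->; apply/forall_inP => b /set1P->; rewrite adj_irr.
Qed.

Lemma clique_leq_omega (G : sgraph) (Q : {set G}) :
  (forall x y, x \in Q -> y \in Q -> x != y -> adj x y) -> (#|Q| <= omega G)%N.
Proof.
move=> hQ; apply: leq_bigmax_cond; apply/forall_inP => x xQ; apply/forall_inP => y yQ.
by apply/implyP; exact: hQ.
Qed.

(** S itself is a competitor for its Hall ratio, and its stability number is at most that of F. With
    F attaining the Hall ratio, a fraction of the vertices of F keeps at least that fraction of the
    ratio. *)
Lemma rho_set_ge (G : sgraph) (S F : {set G}) : S \subset F -> (0 < #|S|)%N ->
  #|S|%:R / (alpha (induced F))%:R <= rho_set S.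
Proof.
move=> SF S0; apply: le_trans (psi_le_rho [set: induced S]).
have cS : #|induced [set: induced S]| = #|S| by rewrite card_induced cardsT card_induced.
rewrite /psi cS S0 ler_pM2l ?ltr0n // lef_pV2 ?posrE ?ltr0n ?alpha_gt0 ?cS ?card_induced //; last first.
  exact: leq_trans S0 (subset_leq_card SF).
rewrite ler_nat.
have vF (z : induced [set: induced S]) : val (val z) \in F by exact: (subsetP SF _ (valP (val z))).
apply: (@leq_alpha (induced [set: induced S]) (induced F)
  (fun z => exist _ (val (val z)) (vF z))) => // x y [] hxy.
by apply: val_inj; apply: val_inj.
Qed.

Lemma rho_edgeless (G : sgraph) : (forall x y : G, ~~ adj x y) -> rho G <= 1.
Proof.
move=> he; apply/bigmax_leP; split=> // S _; rewrite /psi; case: ifP => // S0.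
rewrite ler_pdivrMr ?ltr0n ?alpha_gt0 // mul1r ler_nat -cardsT.
apply: leq_bigmax_cond; apply/forall_inP => x _; apply/forall_inP => y _; exact: he.
Qed.

Lemma rho_set1_ge1 (G : sgraph) (x : G) : 1 <= rho_set [set x].
Proof.
apply: le_trans (rho_set_ge (subxx [set x]) _); rewrite ?cards1 // mul1r.
have a1 : (alpha (induced [set x]) <= 1)%N.
  apply/bigmax_leqP => S _; apply: leq_trans (max_card _) _; by rewrite card_induced cards1.
have a0 : (0 < alpha (induced [set x]))%N by rewrite alpha_gt0 // card_induced cards1.
by have -> : alpha (induced [set x]) = 1%N; [lia | rewrite invr1].
Qed.

(** * From counterexamples for all exponents to an asymptotic one *)

Theorem theorem5p4 (T : sgraph) (forestT : forest T) :
  exists2 d : nat, (2 <= d)%N &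
    forall G : sgraph, ~ complete G -> free_of T G ->
      exists A B : {set G},
        [/\ anticomplete A B,
            (omega G)%:R ^- d * rho G <= rho_set A
          & (omega G)%:R ^- d * rho G <= rho_set B].
Proof.
apply: contrapT => hno.
have [m [par [g [m0 par_lt ginj gm gadj]]]] := forest_te forestT.
have /dchoice [G hG] : forall d, exists G : sgraph, [/\ ~ complete G, free_of T G
   & ~ exists A B : {set G}, [/\ anticomplete A B,
            (omega G)%:R ^- d.+2 * rho G <= rho_set A
          & (omega G)%:R ^- d.+2 * rho G <= rho_set B]].
  move=> d; apply: contrapT => hd; apply: hno; exists d.+2 => // G h1 h2.
  by apply: contrapT => h3; apply: hd; exists G.
(* Otherwise two non-adjacent vertices would form an admissible pair, since singletons have Hall
   ratio at least 1. *)
have rho_gt d : 1 < (omega (G d))%:R ^- d.+2 * rho (G d).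
  have [ncomp _ hn] := hG d; rewrite ltNge; apply/negP => hle.
  have [x [y [xy nadj]]] : exists x y : G d, x != y /\ ~~ adj x y.
    apply: contrapT => h; apply: ncomp => x y xy; apply/negPn/negP => nadj.
    by apply: h; exists x, y.
  apply: hn; exists [set x], [set y]; split.
  - split; first by rewrite disjoints1 inE.
    by move=> a b /set1P-> /set1P->.
  - exact: le_trans hle (rho_set1_ge1 x).
  - exact: le_trans hle (rho_set1_ge1 y).
have w1 d : (1 < omega (G d))%N.
  rewrite ltnNge; apply/negP => w1.
  have he (x y : G d) : ~~ adj x y.
    apply/negP => xy; have xny : x != y by apply: contraTneq xy => ->; rewrite adj_irr.
    have : (#|[set x; y]| <= omega (G d))%N.
      apply: clique_leq_omega => a b; rewrite !inE => /orP[/eqP->|/eqP->] /orP[/eqP->|/eqP->];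
        by rewrite ?eqxx // adj_sym.
    by rewrite cards2 xny; lia.
  (* For clique number 0 the negative power is 0 by convention, for 1 it is 1; either way [rho_gt]
     is violated. *)
  have := rho_gt d; have := rho_edgeless he; case: (omega (G d)) w1 => [|[|//]] _.
    by rewrite expr0n /= invr0 mul0r => _; rewrite ltNge ler01.
  by rewrite expr1n invr1 mul1r => h1; rewrite ltNge h1.
have [F hF] := dchoice (fun d => rho_attained (G d)).
have wp d q : 0 < (omega (G d))%:R ^+ q :> rat by rewrite exprn_gt0 // ltr0n ltnW.
have rho_lt d : (omega (G d))%:R ^+ d.+2 < rho (G d).
  by have := rho_gt d; rewrite mulrC ltr_pdivlMr // mul1r.
have Fpos d : (0 < #|induced (F d)|)%N.
  have := rho_lt d; rewrite hF /psi; case: ifP => // _ hlt.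
  by have := lt_trans (wp d d.+2) hlt; rewrite ltxx.
have rhoE d : rho (G d) = #|induced (F d)|%:R / (alpha (induced (F d)))%:R.
  by rewrite hF /psi Fpos.
have cardF d : (omega (G d) ^ d.+2 <= #|induced (F d)|)%N.
  rewrite -(ler_nat rat) natrX; apply: le_trans (ltW (rho_lt d)) _.
  rewrite rhoE ler_pdivrMr ?ltr0n ?alpha_gt0 // ler_peMr // ler1n; exact: alpha_gt0.
have [U hU] := ultra_exists.
suff : asym by exact: asym_false.
apply: (@Asym U hU (fun d => induced (F d)) (fun d => @adj (induced (F d)))
  (fun d => @adj_sym _) (fun d => @adj_irr _) (fun d => omega (G d)) w1 _ _ m m0 par par_lt _ _).
- move=> q; apply: (ultra1 hU (ultra_cofin hU q)) => d qd.
  by apply: leq_trans (cardF d); rewrite leq_exp2l //; lia.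
- move=> d Q hQ; rewrite -(card_imset _ val_inj); apply: clique_leq_omega.
  move=> _ _ /imsetP[x xQ ->] /imsetP[y yQ ->] xy.
  by apply: (hQ x y xQ yQ); apply: contraNneq xy => ->.
- move=> d f hf; have [_ hfree _] := hG d.
  apply: (@embedding_not_free T (G d) (fun x => val (f (g x)))) hfree.
    move=> x y /val_inj hxy; apply: ginj; apply/eqP/negPn/negP => gxy.
    by have [/(_ gxy)] := hf (g x) (g y) (gm x) (gm y); rewrite hxy eqxx.
  by move=> x y; have [_] := hf (g x) (g y) (gm x) (gm y); rewrite -gadj => <-.
(* At some d with q at most d, the images of [A d] and [B d] contain a fraction [omega ^- q] of the
   maximizer [F d]. By [rho_set_ge] they keep that fraction of the Hall ratio, against the choice of
   [G d]. *)
- move=> A B q dAB hA hB hac.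
  have [d [[[h1 h2] h3] qd]] := ultra_ex hU (ultra_and hU (ultra_and hU
    (ultra_and hU hA hB) hac) (ultra_cofin hU q)).
  have [_ _] := hG d; apply; exists (val @: A d), (val @: B d).
  have side (C : {set induced (F d)}) : (#|induced (F d)| <= omega (G d) ^ q * #|C|)%N ->
      (omega (G d))%:R ^- d.+2 * rho (G d) <= rho_set (val @: C).
    move=> hC; have C0 : (0 < #|C|)%N.
      by rewrite lt0n; apply: contraTneq hC => ->; rewrite muln0 -ltnNge Fpos.
    have cC := card_imset (mem C) (val_inj : injective (val : induced (F d) -> G d)).
    have CF : val @: C \subset F d by apply/subsetP => _ /imsetP[z _ ->]; exact: valP.
    apply: le_trans (rho_set_ge CF _); last by rewrite cC.
    rewrite cC rhoE mulrA ler_pM2r ?invr_gt0 ?ltr0n ?alpha_gt0 //.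
    rewrite mulrC ler_pdivrMr // -natrX -natrM ler_nat mulnC (leq_trans hC) //.
    by rewrite leq_mul2r leq_exp2l ?orbT //; lia.
  split; [split | exact: side | exact: side].
    rewrite -setI_eq0; apply/eqP/setP => x; rewrite !inE; apply/negbTE/negP.
    move=> /andP[/imsetP[a aA ->] /imsetP[b bB /val_inj hab]].
    by have := disjointFr (dAB d) aA; rewrite hab bB.
  by move=> _ _ /imsetP[a aA ->] /imsetP[b bB ->]; exact: (h3 a b aA bB).
Qed.
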